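(* Let $n\ge 5$. Among all trees on $n$ vertices, the maximum of $d_T(S_c(T),\chi(T))$ is attained by some path-star tree $P_{n-g,g}$.
   Context: All graphs are finite, simple, undirected. For subsets $U,V$ of vertices of a tree $T$, $d_T(U,V)=\min\{d(u,v):u\in U,v\in V\}$ where $d(u,v)$ is the number of edges on the $u$–$v$ path. The path-star tree $P_{n-g,g}$ ($2\le g\le n-3$) is obtained by identifying the center of the star $K_{1,g}$ with a pendant vertex of the path $P_{n-g}$. Subtree core: for $v\in V(T)$ let $f_T(v)$ be the number of subtrees of $T$ containing $v$; $S_c(T)$ is the set of vertices maximizing $f_T$. Characteristic set: let $L(T)=D(T)-A(T)$ be the Laplacian matrix, $\mu$ its second smallest eigenvalue and $Y$ an eigenvector for $\mu$ (Fiedler vector). A vertex $v$ is a characteristic vertex if $Y(v)=0$ and some neighbour $u$ has $Y(u)\neq0$; an edge $\{u,v\}$ is a characteristic edge if $Y(u)Y(v)<0$. The characteristic set $\chi(T)$ is the set of characteristic vertices and edges; for a tree it is a single vertex or a single edge, independent of $Y$. An edge is regarded as the set of its two endpoints when computing distances. *)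

(* Defs.v *)
From HB Require Import structures.
From mathcomp Require Import all_boot all_order all_algebra.
From mathcomp Require Import boolp reals complex spectral.

Set Implicit Arguments.
Unset Strict Implicit.
Unset Printing Implicit Defensive.

Import Order.TTheory GRing.Theory Num.Theory.
Local Open Scope ring_scope.

(* A cycle of the graph is a duplicate-free closed walk of length at least 3;
   [:: x; y] with x and y adjacent is a ucycle but not a cycle. *)
Definition is_tree (V : finType) (S : {set V}) (e : rel V) : Prop :=
  [/\ S != set0,
      symmetric e /\ irreflexive e,
      forall x y, e x y -> (x \in S) && (y \in S),
      {in S &, forall x y, connect e x y} &
      forall c : seq V, ucycle e c -> (size c <= 2)%N].

(* A subgraph is a vertex set with an edge set, the latter encoded as the
   symmetric set of ordered pairs of adjacent vertices. *)
Definition is_subtree (V : finType) (e : rel V)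
    (H : {set V} * {set V * V}) : Prop :=
  subrel (fun x y => (x, y) \in H.2) e /\
  is_tree H.1 (fun x y => (x, y) \in H.2).

Definition nb_subtrees (V : finType) (e : rel V) (v : V) : nat :=
  #|[set H : {set V} * {set V * V} | `[< is_subtree e H >] & v \in H.1]|.

Definition subtree_core (V : finType) (e : rel V) : {set V} :=
  [set v | [forall u, (nb_subtrees e u <= nb_subtrees e v)%N]].

(* Length of a shortest simple path from u to v (in a tree, of the only one).
   Such a path has fewer than #|V| edges, so the default value #|V| is taken
   only when u and v are not connected. *)
Definition gdist (V : finType) (e : rel V) (u v : V) : nat :=
  \big[minn/#|V|]_(k < #|V| |
     [exists p : k.-tuple V, [&& path e u p, uniq (u :: p) & last u p == v]]) k.

Definition set_dist (V : finType) (e : rel V) (U W : {set V}) : nat :=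
  \big[minn/#|V|]_(u in U) \big[minn/#|V|]_(w in W) gdist e u w.

Definition laplacian (R : realType) (n : nat) (e : rel 'I_n) : 'M[R]_n :=
  diag_mx (\row_i #|[set j | e i j]|%:R) - \matrix_(i, j) (e i j)%:R.

(* s lists all the eigenvalues with multiplicity, in nondecreasing order. *)
Definition second_smallest_eigenvalue (R : realType) (n : nat)
    (A : 'M[R]_n) (mu : R) : Prop :=
  exists s : seq R,
    [/\ char_poly A = \prod_(x <- s) ('X - x%:P),
        sorted <=%R s, (1 < size s)%N & s`_1 = mu].

Definition is_fiedler_vector (R : realType) (n : nat) (e : rel 'I_n)
    (Y : 'cV[R]_n) : Prop :=
  Y != 0 /\
  exists2 mu, second_smallest_eigenvalue (laplacian R e) mu
            & laplacian R e *m Y = mu *: Y.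

Lemma char_poly_similar (F : fieldType) (n : nat) (P D : 'M[F]_n) :
  P \in unitmx -> char_poly (invmx P *m D *m P) = char_poly D.
Proof.
move=> uP; rewrite /char_poly.
have -> : char_poly_mx (invmx P *m D *m P) =
  map_mx (@polyC F) (invmx P) *m char_poly_mx D *m map_mx (@polyC F) P.
  rewrite /char_poly_mx !map_mxM /= mulmxBr mulmxBl; congr (_ - _).
  by rewrite mul_mx_scalar -scalemxAl -map_mxM mulVmx // map_mx1 scalemx1.
rewrite !det_mulmx mulrC mulrA -det_mulmx -map_mxM mulmxV // map_mx1 det1.
by rewrite mul1r.
Qed.

Lemma laplacian_sym (R : realType) (n : nat) (e : rel 'I_n) :
  symmetric e -> (laplacian R e)^T = laplacian R e.
Proof.
move=> es; rewrite /laplacian linearB /= tr_diag_mx; congr (_ - _).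
by apply/matrixP => i j; rewrite !mxE es.
Qed.

Lemma sym_real_spectrum (R : realType) (n : nat) (A : 'M[R]_n) : A^T = A ->
  exists2 s : seq R, size s = n & char_poly A = \prod_(x <- s) ('X - x%:P).
Proof.
move=> sA; pose f := real_complex R; pose AC := map_mx f A.
have symAC : AC \is symmetricmx.
  apply/is_hermitianmxP; rewrite expr0 scale1r map_mx_id //.
  by apply/matrixP => i j; rewrite !mxE -{1}sA mxE.
have realAC : AC \is a realmx.
  by apply/mxOverP => i j; rewrite mxE; apply/complex_realP; exists (A i j).
have /orthomx_spectralP EA := symmetric_normalmx symAC realAC.
have /mxOverP rd := hermitian_spectral_diag_real (realsym_hermsym symAC realAC).
set d := spectral_diag AC in EA rd.
exists [seq complex.Re (d 0 i) | i <- enum 'I_n].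
  by rewrite size_map size_enum_ord.
apply: (@map_poly_inj _ _ f); rewrite map_char_poly -/AC EA.
rewrite char_poly_similar ?spectral_unit // char_poly_trig ?diag_mx_is_trig //.
rewrite rmorph_prod big_map big_enum /=; apply: eq_bigr => i _.
rewrite rmorphB /= map_polyX map_polyC /= mxE eqxx mulr1n.
by rewrite /f RRe_real.
Qed.

(* Hence quantifying over all Fiedler vectors of a tree is never vacuous. *)
Lemma fiedler_vector_exists (R : realType) (n : nat) (e : rel 'I_n) :
  (1 < n)%N -> symmetric e -> exists Y : 'cV[R]_n, is_fiedler_vector e Y.
Proof.
move=> n_gt1 /(laplacian_sym R) sL.
have [s ss cs] := sym_real_spectrum sL.
pose t := sort <=%R s.
have tE : char_poly (laplacian R e) = \prod_(x <- t) ('X - x%:P).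
  by rewrite cs; apply: perm_big; rewrite perm_sym perm_sort.
have t1 : (1 < size t)%N by rewrite size_sort ss.
have : eigenvalue (laplacian R e) t`_1.
  by rewrite eigenvalue_root_char tE root_prod_XsubC mem_nth.
case/eigenvalueP => v vE v0; exists v^T; split.
  by apply: contraNneq v0 => /(congr1 trmx); rewrite trmxK trmx0 => ->.
exists t`_1; last by rewrite -{1}sL -trmx_mul vE linearZ.
by exists t; split=> //; apply: sort_sorted; exact: le_total.
Qed.

Definition char_vertex (R : realType) (n : nat) (e : rel 'I_n)
    (Y : 'cV[R]_n) (v : 'I_n) : bool :=
  (Y v 0 == 0) && [exists u, e v u && (Y u 0 != 0)].

Definition char_edge (R : realType) (n : nat) (e : rel 'I_n)
    (Y : 'cV[R]_n) (u v : 'I_n) : bool :=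
  e u v && (Y u 0 * Y v 0 < 0).

(* The vertex v is represented by [set v] and the edge uv by [set u; v], so
   that cover (char_set e Y) is the vertex set from which distances to the
   characteristic set are measured. *)
Definition char_set (R : realType) (n : nat) (e : rel 'I_n)
    (Y : 'cV[R]_n) : {set {set 'I_n}} :=
  [set [set v] | v in char_vertex e Y] :|:
  [set [set uv.1; uv.2] | uv in [pred uv | char_edge e Y uv.1 uv.2]].

Definition dist_core_char (R : realType) (n : nat) (e : rel 'I_n)
    (Y : 'cV[R]_n) : nat :=
  set_dist e (subtree_core e) (cover (char_set e Y)).

(* The vertices 0, ..., n-g-1 form the path, and the g remaining vertices are
   the leaves of the star centered at n-g-1. *)
Definition path_star (n g : nat) : rel 'I_n := fun i j =>
  let arc (a b : nat) :=
    ((b < n - g) && (a.+1 == b) || (n - g <= b) && (a.+1 == n - g))%N in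
  arc i j || arc j i.

(* Main.v *)
(** Fix g as the least integer with n - 1 < 2^g + g; the center of P_{n-g,g} is
    then the only vertex of its subtree core. In a tree T, let v in S_c(T) and
    r in chi(T) realise the distance d > 0, and let v1 follow v on the path to r.
    Since v1 has fewer subtrees than v, the branch of v away from v1 has at least
    g + 1 vertices. The negative or positive part of a Fiedler vector beyond r
    is a test function psi with Rayleigh quotient at most mu, and its decreasing
    rearrangement fits on the path of P_{n-g,g} beyond the vertex at distance d
    from the center. As functions with disjoint nonadjacent supports combine to
    one of sum zero, every test function on the side of v has quotient at least
    mu; applied to functions constant along branches this gives the same bound
    on the ball of radius d - 1 around the center of P_{n-g,g}. If chi(P_{n-g,g})
    met that ball, some test function there would have quotient smaller than
    the Fiedler value mu' of P_{n-g,g}; so mu < mu', and it would combine with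
    the rearranged psi into a violation of the variational description of mu'. *)

Require Import Defs.
From mathcomp Require Import all_boot all_order all_algebra.
From mathcomp Require Import boolp reals complex spectral perm.
From mathcomp Require Import zify ring lra.

Set Implicit Arguments.
Unset Strict Implicit.
Unset Printing Implicit Defensive.

Import Order.TTheory GRing.Theory Num.Theory.
Local Open Scope ring_scope.

Local Open Scope sesquilinear_scope.

(** * Spectral gap *)

Section GraphForms.
Variables (R : realType) (V : finType) (e : rel V).
Implicit Types f g : V -> R.

Definition lap f (x : V) : R := \sum_(y | e x y) (f x - f y).

(* Every edge is counted twice, once in each direction. *)
Definition energy f : R := \sum_x \sum_(y | e x y) (f x - f y) ^+ 2.

Definition sqnorm f : R := \sum_x f x ^+ 2.

Lemma energy_ge0 f : 0 <= energy f.
Proof. by apply: sumr_ge0 => x _; apply: sumr_ge0 => y _; exact: sqr_ge0. Qed.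

Lemma sqnorm_ge0 f : 0 <= sqnorm f.
Proof. by apply: sumr_ge0 => x _; exact: sqr_ge0. Qed.

Lemma energy_eq0 f x y : energy f = 0 -> e x y -> f x = f y.
Proof.
move=> /eqP; rewrite psumr_eq0 => [/allP/(_ x (mem_index_enum _))|x' _]; last first.
  by apply: sumr_ge0 => z _; exact: sqr_ge0.
rewrite /= psumr_eq0 => [/allP/(_ y (mem_index_enum _))|z _]; last exact: sqr_ge0.
by move=> /implyP h exy; apply/eqP; move: (h exy); rewrite sqrf_eq0 subr_eq0.
Qed.

Lemma energy_connect f x y : energy f = 0 -> connect e x y -> f x = f y.
Proof.
move=> f0 /connectP [p pp ->]; elim: p x pp => //= z p IHp x /andP [exz pz].
by rewrite (energy_eq0 f0 exz); exact: IHp.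
Qed.

Hypothesis sym_e : symmetric e.

Lemma sum_lap f g : \sum_x f x * lap g x = \sum_x lap f x * g x.
Proof.
have E u v : \sum_x u x * lap v x =
    \sum_x \sum_(y | e x y) u x * v x - \sum_x \sum_(y | e x y) u x * v y :> R.
  rewrite -sumrB; apply: eq_bigr => x _; rewrite -sumrB mulr_sumr.
  by apply: eq_bigr => y _; rewrite mulrBr.
transitivity (\sum_x g x * lap f x); last first.
  by apply: eq_bigr => x _; rewrite mulrC.
rewrite !E.
congr (_ - _).
  by apply: eq_bigr => x _; apply: eq_bigr => y _; rewrite mulrC.
rewrite (exchange_big_dep predT) //=; apply: eq_bigr => x _.
by apply: eq_big => [y|y _]; rewrite 1?sym_e // mulrC.
Qed.

Lemma energyE f : energy f = 2 * \sum_x f x * lap f x.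
Proof.
have E : \sum_x f x * lap f x = \sum_x \sum_(y | e x y) f x * (f x - f y).
  by apply: eq_bigr => x _; rewrite mulr_sumr.
have E' : \sum_x f x * lap f x = \sum_x \sum_(y | e x y) f y * (f y - f x).
  rewrite E (exchange_big_dep predT) //=; apply: eq_bigr => x _.
  by apply: eq_bigl => y; rewrite sym_e.
rewrite mulr_natl mulr2n {1}E E' -big_split /=; apply: eq_bigr => x _.
by rewrite -big_split /=; apply: eq_bigr => y _; ring.
Qed.

End GraphForms.

Lemma laplacian_lap (R : realType) (n : nat) (e : rel 'I_n) (Y : 'cV[R]_n) x :
  irreflexive e ->
  (laplacian R e *m Y) x 0 = lap e (fun i => Y i 0) x.
Proof.
move=> eirr; rewrite mulmxBl !mxE (bigD1 x) //= !mxE eqxx mulr1n big1 ?addr0.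
  rewrite /lap sumrB sumr_const; congr (_ - _).
    by rewrite cardsE mulr_natl.
  rewrite [RHS]big_mkcond /=; apply: eq_bigr => i _; rewrite !mxE.
  by case: (e x i); rewrite ?mul1r ?mul0r.
by move=> i ix; rewrite !mxE eq_sym (negPf ix) mul0r.
Qed.

Section Spectral.
Variables (R : realType) (n : nat).

(** Diagonalisation takes place over [R[i]], where a real symmetric matrix is hermitian. Its
    eigenvalues are then real, so [d] lives over [R] while [P] stays complex. *)
Lemma sym_spectral (A : 'M[R]_n) : A^T = A ->
  exists (P : 'M[R[i]]_n) (d : 'rV[R]_n),
    [/\ P \is unitarymx,
        map_mx (real_complex R) A =
          P ^t* *m diag_mx (map_mx (real_complex R) d) *m P &
        char_poly A = \prod_(i < n) ('X - (d 0 i)%:P)].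
Proof.
move=> sA; pose f := real_complex R; pose AC := map_mx f A.
have symAC : AC \is symmetricmx.
  apply/is_hermitianmxP; rewrite expr0 scale1r map_mx_id //.
  by apply/matrixP => i j; rewrite !mxE -{1}sA mxE.
have realAC : AC \is a realmx.
  by apply/mxOverP => i j; rewrite mxE; apply/complex_realP; exists (A i j).
have /orthomx_spectralP EA := symmetric_normalmx symAC realAC.
have /mxOverP rd := hermitian_spectral_diag_real (realsym_hermsym symAC realAC).
pose d : 'rV[R]_n := \row_i complex.Re (spectral_diag AC 0 i).
have dE : map_mx f d = spectral_diag AC.
  by apply/rowP => i; rewrite !mxE /f RRe_real.
exists (spectralmx AC), d; split; first exact: spectral_unitarymx.
  by rewrite dE -invmx_unitary ?spectral_unitarymx.
apply: (@map_poly_inj _ _ f); rewrite map_char_poly -/AC EA.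
rewrite char_poly_similar ?spectral_unit // char_poly_trig ?diag_mx_is_trig //.
rewrite rmorph_prod /=; apply: eq_bigr => i _.
by rewrite rmorphB /= map_polyX map_polyC /= mxE eqxx mulr1n -dE mxE.
Qed.

(** Both lists of roots split the same polynomial, so [s] is a permutation of the entries of [d];
    [i] and [j] are the places of the first two entries of [s]. *)
Lemma second_eigenvalue_index (A : 'M[R]_n) (d : 'rV[R]_n) mu :
  char_poly A = \prod_(i < n) ('X - (d 0 i)%:P) ->
  second_smallest_eigenvalue A mu ->
  exists i j, [/\ i != j, d 0 i <= mu, d 0 j = mu &
                  forall k, k != i -> mu <= d 0 k].
Proof.
move=> dE [s [sE ss s1 smu]].
have szs : size s = n.
  by have := size_char_poly A; rewrite sE size_prod_XsubC => -[].
have : perm_eq s [tuple d 0 i | i < n].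
  apply: prod_XsubC_eq; rewrite -sE dE /= big_map big_enum /=.
  by apply: eq_bigr.
case/tuple_permP => p sp.
have nthp (i : 'I_n) : s`_i = d 0 (p i).
  rewrite sp (nth_map i) ?size_enum_ord // nth_ord_enum.
  by rewrite tnth_map tnth_ord_tuple.
have n1 : (1 < n)%N by rewrite -szs.
pose i0 := Ordinal (ltnW n1); pose i1 := Ordinal n1.
have le_nth := sorted_leq_nth (@le_trans _ R) (@le_refl _ R) 0 ss.
exists (p i0), (p i1); split.
- by rewrite (inj_eq perm_inj).
- by rewrite -nthp -smu; apply: le_nth; rewrite ?inE ?szs.
- by rewrite -nthp smu.
move=> k; rewrite -[k](permKV p) (inj_eq perm_inj) -nthp -smu => ki.
apply: le_nth; rewrite ?inE ?szs //.
by rewrite lt0n; apply: contra ki => /eqP h; apply/eqP/val_inj.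
Qed.

Variable e : rel 'I_n.
Hypotheses (sym_e : symmetric e) (eirr : irreflexive e).
Variable mu : R.
Hypothesis mu2 : second_smallest_eigenvalue (laplacian R e) mu.

Local Notation RC := (real_complex R).
Let L := laplacian R e.

Lemma row_laplacian (f : 'I_n -> R) x : ((\row_i f i) *m L) 0 x = lap e f x.
Proof.
have -> : (\row_i f i) = (\col_i f i)^T by apply/rowP => i; rewrite !mxE.
rewrite /L -(laplacian_sym R sym_e) -trmx_mul mxE laplacian_lap //.
rewrite /lap; apply: eq_big => // i _; by rewrite !mxE.
Qed.

(** When [mu] is positive, the constant function has a coordinate in the eigenbasis [P] only at
    [i0]. A function of sum zero therefore has none there, and all other eigenvalues are at least
    [mu]. The factor 2 matches the double counting of edges in [energy]. *)
Lemma spectral_gap (f : 'I_n -> R) : \sum_i f i = 0 ->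
  2 * mu * sqnorm f <= energy e f.
Proof.
move=> f0; have [mu0|mu0] := leP mu 0.
  apply: le_trans (energy_ge0 e f); rewrite -mulrA pmulr_rle0 //.
  by apply: mulr_le0_ge0 => //; exact: sqnorm_ge0.
have [P [d [uP AE cE]]] := sym_spectral (laplacian_sym R sym_e).
have [i0 [j0 [_ _ _ dmin]]] := second_eigenvalue_index cE mu2.
pose D := diag_mx (map_mx RC d).
pose c (g : 'I_n -> R) := map_mx RC (\row_i g i) *m P ^t*.
have cK g : c g *m P = map_mx RC (\row_i g i) by rewrite mulmxKtV.
have cKt g : P ^t* *m (c g)^t* = (map_mx RC (\row_i g i))^t*.
  by rewrite -(cK g) [in RHS]trmx_mul map_mxM.
have rt g : (map_mx RC (\row_i g i))^t* = map_mx RC (\col_i g i).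
  by apply/matrixP => i j; rewrite !mxE; exact: conjc_real.
have dotE g h : RC (\sum_i g i * h i) = \sum_i c g 0 i * (c h 0 i)^*.
  transitivity ((map_mx RC (\row_i g i) *m (map_mx RC (\row_i h i))^t*) 0 0).
    rewrite rt -map_mxM !mxE; congr RC; apply: eq_bigr => i _; by rewrite !mxE.
  rewrite -cKt mulmxA -/(c g) mxE; apply: eq_bigr => i _.
  by rewrite !mxE.
have lapE g : c (lap e g) = c g *m D.
  rewrite /c -[map_mx RC (\row_i lap e g i)](_ : map_mx RC (\row_i g i *m L) = _).
    rewrite map_mxM AE !mulmxA -[_ *m P *m P ^t*]mulmxA.
    by rewrite (unitarymxP uP) mulmx1.
  by apply/rowP => i; rewrite mxE row_laplacian !mxE.
have lapEi g i : c (lap e g) 0 i = c g 0 i * RC (d 0 i).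
  by rewrite lapE mul_mx_diag !mxE.
(* Constants are annihilated by [lap], while the eigenvalues away from [i0] are at least [mu], hence
   nonzero. *)
have one0 i : i != i0 -> c (fun=> 1) 0 i = 0.
  move=> ii0; have := lapEi (fun=> 1) i.
  have -> : c (lap e (fun=> 1)) = 0.
    rewrite /c (_ : (\row_i _) = 0) ?map_mx0 ?mul0mx //.
    by apply/rowP => k; rewrite !mxE /lap big1 // => ? _; rewrite subrr.
  rewrite mxE => /esym/eqP; rewrite mulf_eq0 => /orP [/eqP //|].
  have := dmin i ii0 => h; rewrite fmorph_eq0 => /eqP h0.
  by move: h; rewrite h0 leNgt mu0.
(* Orthogonality of [f] to the constants leaves a vanishing product of two coordinates at [i0]; the
   factor of the constant function is nonzero, as it has no other coordinate. *)
have y0 : c f 0 i0 = 0.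
  have := dotE f (fun=> 1); rewrite (eq_bigr f) => [|i _]; last by rewrite mulr1.
  rewrite f0 rmorph0 (bigD1 i0) //= big1 ?addr0 => [|i /one0 ->]; last first.
    by rewrite conjC0 mulr0.
  move/esym/eqP; rewrite mulf_eq0 => /orP [/eqP //|].
  rewrite conjC_eq0 => /eqP z0.
  have := cK (fun=> 1); have -> : c (fun=> 1) = 0.
    by apply/rowP => i; rewrite [RHS]mxE; have [->|/one0] := eqVneq i i0.
  rewrite mul0mx => /rowP/(_ i0); rewrite !mxE => /eqP.
  by rewrite eq_sym fmorph_eq0 oner_eq0.
rewrite energyE // -mulrA ler_pM2l // -lecR.
have -> : (\sum_x f x * lap e f x)%:C%C = \sum_i RC (d 0 i) * (c f 0 i * (c f 0 i)^*).
  rewrite -[LHS]/(RC _) (eq_bigr (fun x => lap e f x * f x)) => [|x _].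
    by rewrite dotE; apply: eq_bigr => i _; rewrite lapEi mulrAC mulrC.
  by rewrite mulrC.
have -> : (mu * sqnorm f)%:C%C = \sum_i RC mu * (c f 0 i * (c f 0 i)^*).
  rewrite -[LHS]/(RC _) rmorphM /= -mulr_sumr -dotE; congr (_ * RC _).
apply: ler_sum => i _; have [->|ii0] := eqVneq i i0.
  by rewrite y0 !mul0r !mulr0.
by apply: ler_wpM2r; [exact: mul_conjC_ge0 | rewrite lecR; exact: dmin].
Qed.

Lemma kernel_const (f : 'I_n -> R) a : (forall x y, connect e x y) ->
  a <= 0 -> (forall x, lap e f x = a * f x) -> forall x y, f x = f y.
Proof.
move=> econn a0 fE x y; apply: energy_connect (econn x y).
apply/eqP; rewrite eq_le energy_ge0 andbT energyE // pmulr_rle0 //.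
rewrite (eq_bigr (fun x => a * (f x ^+ 2))) => [|z _]; last by rewrite fE; ring.
by rewrite -mulr_sumr mulr_le0_ge0 // sqnorm_ge0.
Qed.

(** Otherwise the rows [i0] and [j0] of [P] both belong to eigenvalues at most 0 and are constant by
    connectedness; two nonzero constant vectors are not orthogonal. *)
Lemma fiedler_value_gt0 : (forall x y, connect e x y) -> 0 < mu.
Proof.
move=> econn; rewrite ltNge; apply/negP => mu0.
have [P [d [uP AE cE]]] := sym_spectral (laplacian_sym R sym_e).
have [i0 [j0 [ij0 di dj _]]] := second_eigenvalue_index cE mu2.
have {}di := le_trans di mu0.
have PA : P *m map_mx RC L = diag_mx (map_mx RC d) *m P.
  by rewrite AE !mulmxA (unitarymxP uP) mul1mx.
(* Here [h] is the real or the imaginary part, so that [kernel_const] applies to each part of a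
   complex row. *)
have lapP (h : {additive R[i] -> R}) i : (forall z r, h (z * RC r) = h z * r) ->
    forall x, lap e (fun k => h (P i k)) x = d 0 i * h (P i x).
  move=> hM x; rewrite -row_laplacian mxE.
  transitivity (h ((P *m map_mx RC L) i x)).
    by rewrite mxE raddf_sum; apply: eq_bigr => k _; rewrite !mxE hM.
  by rewrite PA mul_diag_mx !mxE [_ * P i x]mulrC hM mulrC.
have ReM (z : R[i]) r : complex.Re (z * RC r) = complex.Re z * r.
  by case: z => a b /=; rewrite mulr0 subr0.
have ImM (z : R[i]) r : complex.Im (z * RC r) = complex.Im z * r.
  by case: z => a b /=; rewrite mulr0 add0r.
have constP i : d 0 i <= 0 -> forall x y, P i x = P i y.
  move=> di0 x y; apply/eqP; rewrite eq_complex.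
  rewrite (kernel_const econn di0 (lapP (@complex.Re R) i (ReM)) x y).
  by rewrite (kernel_const econn di0 (lapP (@complex.Im R) i (ImM)) x y) !eqxx.
have PP i j : \sum_k P i k * (P j k)^* = (i == j)%:R.
  have /unitarymxP/matrixP/(_ i j) := uP; rewrite !mxE => <-.
  by apply: eq_bigr => k _; rewrite !mxE.
have := PP i0 j0; rewrite (negPf ij0) mulr0n.
rewrite (eq_bigr (fun=> P i0 i0 * (P j0 j0)^*)) => [|k _]; last first.
  by rewrite (constP _ di k i0) (constP j0 _ k j0) // dj.
move/eqP; rewrite sumr_const -mulr_natl !mulf_eq0 conjC_eq0 pnatr_eq0.
have H i : d 0 i <= 0 -> P i i != 0.
  move=> dile; apply/eqP => z; have := PP i i; rewrite eqxx big1 => [|k _].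
    by move/eqP; rewrite eq_sym oner_eq0.
  by rewrite (constP i dile k i) z mul0r.
rewrite (negPf (H i0 di)) (negPf (H j0 _)) ?dj // !orbF card_ord.
by move/eqP => n0; case: (i0); rewrite n0.
Qed.

End Spectral.

(** * Test functions and the characteristic set *)

Section Variational.
Variables (R : realType) (V : finType) (e : rel V) (mu : R).
Hypothesis sym_e : symmetric e.
Implicit Types (f g Y : V -> R) (S : {set V}).

(** The combination [a * phi - b * psi], with [a] and [b] the sums of [psi] and [phi], has sum zero,
    and its cross terms vanish in both forms. The gap for it, less the bound on [psi], is the gap
    for [phi]. *)
Lemma disjoint_supports (phi psi : V -> R) :
  (forall f, \sum_x f x = 0 -> 2 * mu * sqnorm f <= energy e f) ->
  (forall x y, phi x != 0 -> psi y != 0 -> x != y /\ ~~ e x y) ->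
  0 < \sum_x psi x -> energy e psi <= 2 * mu * sqnorm psi ->
  2 * mu * sqnorm phi <= energy e phi.
Proof.
move=> gap disj a0 Epsi.
have dj x y : (x == y) || e x y -> phi x * psi y = 0.
  have [->|px] := eqVneq (phi x) 0; first by rewrite mul0r.
  have [->|py] := eqVneq (psi y) 0; first by rewrite mulr0.
  by have [/negPf -> /negPf ->] := disj x y px py.
set a := \sum_x psi x in a0; pose b := \sum_x phi x.
pose f x := a * phi x - b * psi x.
have f0 : \sum_x f x = 0 by rewrite sumrB -!mulr_sumr mulrC subrr.
have Ef : energy e f = a ^+ 2 * energy e phi + b ^+ 2 * energy e psi.
  rewrite /energy !mulr_sumr -big_split; apply: eq_bigr => x _ /=.
  rewrite !mulr_sumr -big_split; apply: eq_bigr => y exy /=.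
  have h1 : phi x * psi y = 0 by rewrite dj ?exy ?orbT.
  have h2 : phi y * psi x = 0 by rewrite dj // sym_e exy orbT.
  have h3 : phi x * psi x = 0 by rewrite dj ?eqxx.
  have h4 : phi y * psi y = 0 by rewrite dj ?eqxx.
  rewrite /f; ring: h1 h2 h3 h4.
have Sf : sqnorm f = a ^+ 2 * sqnorm phi + b ^+ 2 * sqnorm psi.
  rewrite /sqnorm !mulr_sumr -big_split; apply: eq_bigr => x _ /=.
  have h3 : phi x * psi x = 0 by rewrite dj ?eqxx.
  rewrite /f; ring: h3.
have := gap f f0; rewrite Ef Sf => H.
have b2 : b ^+ 2 * (energy e psi - 2 * mu * sqnorm psi) <= 0.
  by rewrite mulr_ge0_le0 ?sqr_ge0 // subr_le0.
have a2 : 0 < a ^+ 2 by rewrite exprn_gt0.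
by rewrite -(ler_pM2l a2); lra.
Qed.

(** The polarisation of the defect [energy e f - 2 * mu * sqnorm f], up to a factor 2. *)
Definition mform f g : R := \sum_x f x * (lap e g x - mu * g x).

Lemma mformE f : 2 * mform f f = energy e f - 2 * mu * sqnorm f.
Proof.
rewrite energyE // -mulrA -mulrBr /sqnorm mulr_sumr -sumrB; congr (_ * _).
by apply: eq_bigr => x _; ring.
Qed.

Lemma mform_sym f g : mform f g = mform g f.
Proof.
have E u v : mform u v = \sum_x u x * lap e v x - mu * \sum_x u x * v x.
  by rewrite mulr_sumr -sumrB; apply: eq_bigr => x _; ring.
rewrite !E (sum_lap sym_e); congr (_ - _ * _); apply: eq_bigr => x _; exact: mulrC.
Qed.

Lemma mform_lin f g h t :
  mform f (fun x => g x + t * h x) = mform f g + t * mform f h.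
Proof.
rewrite /mform mulr_sumr -big_split; apply: eq_bigr => x _ /=.
have -> : lap e (fun x => g x + t * h x) x = lap e g x + t * lap e h x.
  by rewrite /lap mulr_sumr -big_split; apply: eq_bigr => y _ /=; ring.
by ring.
Qed.

Lemma mform_delta f z : mform (fun x => (x == z)%:R) f = lap e f z - mu * f z.
Proof.
rewrite /mform (bigD1 z) //= eqxx mul1r big1 ?addr0 // => x /negPf ->.
by rewrite mul0r.
Qed.

(** First variation: in the direction of the point mass at [z] the quadratic form has derivative
    proportional to [lap e f z - mu * f z], so a small step against it strictly lowers the form. *)
Lemma strict_perturbation f z :
  energy e f <= 2 * mu * sqnorm f -> lap e f z != mu * f z ->
  exists2 g, energy e g < 2 * mu * sqnorm g &
             forall x, x != z -> g x = f x.
Proof.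
move=> Ef ne; pose d x : R := (x == z)%:R.
set c := lap e f z - mu * f z; pose k := mform d d.
have c0 : 0 < c ^+ 2 by rewrite exprn_even_gt0 //= subr_eq0.
(* The step [- c * s] changes the form by [c ^+ 2 * s * (s * k - 2)]; this choice of [s] ensures
   [s * k < 1]. *)
pose s := (`|k| + 1)^-1; have k1 : 0 < `|k| + 1 by rewrite ltr_wpDl.
have s0 : 0 < s by rewrite invr_gt0.
exists (fun x => f x + (- c * s) * d x) => [|x /negPf xz]; last first.
  by rewrite /d xz mulr0 addr0.
rewrite -subr_lt0 -mformE pmulr_rlt0 // mform_lin (mform_sym _ f) (mform_sym _ d).
rewrite !mform_lin (mform_sym f d) mform_delta -/c -/k.
have Eff : mform f f <= 0 by rewrite -(pmulr_rle0 _ (ltr0n R 2)) mformE subr_le0.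
have sk : s * k < 1.
  rewrite /s mulrC ltr_pdivrMr // mul1r.
  by apply: le_lt_trans (ler_norm k) _; rewrite ltrDl.
have cs : 0 < c ^+ 2 * s := mulr_gt0 c0 s0.
have : c ^+ 2 * s * (s * k - 1) < 0 by rewrite (pmulr_rlt0 _ cs) subr_lt0.
nra.
Qed.

Lemma lapN f x : lap e (fun y => - f y) x = - lap e f x.
Proof. by rewrite /lap -sumrN; apply: eq_bigr => y _; rewrite opprB addrC opprK. Qed.

Definition negpart (S : {set V}) Y (x : V) : R :=
  if x \in S then Num.max (- Y x) 0 else 0.

Lemma negpart_ge0 S Y x : 0 <= negpart S Y x.
Proof. by rewrite /negpart; case: ifP; rewrite ?le_max ?lexx ?orbT. Qed.

Lemma negpart_gt0 S Y x : x \in S -> Y x < 0 -> negpart S Y x = - Y x.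
Proof.
by move=> xS Yx; rewrite /negpart xS; apply/max_idPl; rewrite oppr_ge0 ltW.
Qed.

Lemma negpart_neq0 S Y x : negpart S Y x != 0 -> x \in S /\ Y x < 0.
Proof.
rewrite /negpart; case: ifP => [xS|]; last by rewrite eqxx.
have [Yx|//] := leP 0 (Y x).
by rewrite (max_idPr _) ?eqxx // oppr_le0.
Qed.

(* The values of Y on the neighbours outside S only help, being nonnegative. *)
Lemma negpart_lap S Y x :
  (forall z, lap e Y z = mu * Y z) ->
  (forall x y, x \in S -> e x y -> y \notin S -> 0 <= Y y) ->
  x \in S -> Y x < 0 -> lap e (negpart S Y) x <= mu * negpart S Y x.
Proof.
move=> YE bd xS Yx; rewrite (negpart_gt0 xS Yx) mulrN -YE -lapN.
apply: ler_sum => y exy; rewrite (negpart_gt0 xS Yx) lerD2l lerN2 /negpart.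
case: ifP => [_|/negbT yS]; first by rewrite le_max lexx.
by rewrite oppr_le0; exact: bd xS exy yS.
Qed.

(** The negative part is a subsolution wherever it is positive; multiplying by it and summing leaves
    only such vertices. *)
Lemma negpart_energy S Y :
  (forall z, lap e Y z = mu * Y z) ->
  (forall x y, x \in S -> e x y -> y \notin S -> 0 <= Y y) ->
  energy e (negpart S Y) <= 2 * mu * sqnorm (negpart S Y).
Proof.
move=> YE bd; rewrite -subr_le0 -mformE pmulr_rle0 //.
apply: sumr_le0 => x _.
have [->|/negpart_neq0 [xS Yx]] := eqVneq (negpart S Y x) 0; first by rewrite mul0r.
by rewrite mulr_ge0_le0 ?negpart_ge0 // subr_le0; exact: negpart_lap.
Qed.

(** Either a characteristic vertex or an endpoint of a characteristic edge, that is, a vertex from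
    which distances to the characteristic set are measured. *)
Definition char_pt Y (z : V) : Prop :=
  (Y z = 0 /\ exists2 u, e z u & Y u != 0) \/ (exists2 w, e z w & Y z * Y w < 0).

Lemma char_pt_opp Y z : char_pt Y z -> char_pt (fun x => - Y x) z.
Proof.
case=> [[Yz [u zu Yu]]|[w zw Yw]]; [left|right].
  by split; [rewrite Yz oppr0 | exists u; rewrite ?oppr_eq0].
by exists w; rewrite ?mulrNN.
Qed.

(** At a zero of an eigenfunction the neighbouring values sum to zero, so if none is negative they
    all vanish. *)
Lemma zero_neighbours Y z : lap e Y z = mu * Y z -> Y z = 0 ->
  (forall u, e z u -> 0 <= Y u) -> forall u, e z u -> Y u = 0.
Proof.
move=> YE Yz pos u zu; move: YE; rewrite Yz mulr0 /lap => /eqP.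
rewrite (eq_bigr (fun y => - Y y)) => [|y _]; last by rewrite Yz sub0r.
rewrite sumrN oppr_eq0 psumr_eq0 // => /allP/(_ u (mem_index_enum _)).
by rewrite zu => /eqP.
Qed.

(** Applying [zero_neighbours] to [Y] and to its opposite gives a characteristic vertex neighbours
    of both signs. *)
Lemma char_pt_neighbours Y z : lap e Y z = mu * Y z -> char_pt Y z ->
  (exists2 w, e z w & Y z * Y w < 0) \/
  (Y z = 0 /\ exists u w, [/\ e z u, e z w, 0 < Y u & Y w < 0]).
Proof.
move=> YE [[Yz [u zu Yu]]|]; [right; split=> // | by left].
have H (Y' : V -> R) : lap e Y' z = mu * Y' z -> Y' z = 0 -> Y' u != 0 ->
    exists2 w, e z w & Y' w < 0.
  move=> YE' Yz' Yu'.
  have [|nex] := boolP [exists w, e z w && (Y' w < 0)].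
    by case/existsP => w /andP [? ?]; exists w.
  case/eqP: Yu'; apply: zero_neighbours YE' Yz' _ _ zu => w zw.
  rewrite leNgt; apply: contra nex => h; apply/existsP; exists w; exact/andP.
have [w zw Yw] := H Y YE Yz Yu.
have [|||w' zw' Yw'] := H (fun x => - Y x); rewrite ?Yz ?oppr0 ?oppr_eq0 //.
  by rewrite lapN YE Yz ?oppr0 !mulr0 ?oppr0.
by exists w', w; split; rewrite // -oppr_lt0.
Qed.

(** The set [B] can be left only through [r]. Up to a change of sign [Y] is negative at [w] and
    nonnegative at [r], so the negative part of [Y] on [B] serves as [psi]. *)
Lemma char_outside_le Y (B : {set V}) (r w : V) :
  (forall z, lap e Y z = mu * Y z) ->
  (forall x y, x \in B -> e x y -> y \notin B -> y = r) ->
  w \in B -> (Y r = 0 /\ Y w != 0) \/ (Y r * Y w < 0) ->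
  exists psi : V -> R, [/\ forall x, 0 <= psi x, forall x, x \notin B -> psi x = 0,
    0 < psi w & energy e psi <= 2 * mu * sqnorm psi].
Proof.
move=> YE bd wB Yrw; wlog Yw : Y YE Yrw / Y w < 0.
  move=> W; have [||Yw] := ltrgtP (Y w) 0; first exact: W YE Yrw.
    move=> Yw; apply: (W (fun x => - Y x)); rewrite ?oppr_lt0 //.
      by move=> z; rewrite lapN YE mulrN.
    by case: Yrw => [[-> ?]|]; [left; rewrite oppr0 oppr_eq0 | right; rewrite mulrNN].
  by move: Yrw; rewrite Yw mulr0 ltxx eqxx; case=> // -[].
have Yr : 0 <= Y r by case: Yrw => [[-> //]|h]; rewrite leNgt; apply/negP => ?; nra.
exists (negpart B Y); split; first exact: negpart_ge0.
- by move=> x /negPf xB; rewrite /negpart xB.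
- by rewrite negpart_gt0 // oppr_gt0.
by apply: negpart_energy => // x y xB xy /(bd _ _ xB xy) ->.
Qed.

(** Up to a change of sign [Y] is nonnegative at [q], so its negative part [phi] on [S] satisfies
    the non-strict bound. Strictness comes from a perturbation at a vertex of [S] where [phi] fails
    the eigenvalue equation; a characteristic point in [S] forces such a vertex to exist. *)
Lemma char_inside_lt Y (S : {set V}) (q z : V) :
  (forall x, lap e Y x = mu * Y x) ->
  (forall x y, x \in S -> y \in S ->
     connect [rel u w | [&& e u w, u \in S & w \in S]] x y) ->
  (forall x y, x \in S -> e x y -> y \notin S -> y = q) -> q \notin S ->
  z \in S -> char_pt Y z ->
  exists2 phi : V -> R, energy e phi < 2 * mu * sqnorm phi &
    forall x, x \notin S -> phi x = 0.
Proof.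
move=> YE Sconn bd qS zS chz; wlog Yq : Y YE chz / 0 <= Y q.
  move=> W; have [/(W Y)|Yq] := leP 0 (Y q); first exact.
  apply: (W (fun x => - Y x)); last by rewrite oppr_ge0 ltW.
    by move=> x; rewrite lapN YE mulrN.
  exact: char_pt_opp.
have bdY x y : x \in S -> e x y -> y \notin S -> 0 <= Y y.
  by move=> xS xy /(bd _ _ xS xy) ->.
set phi := negpart S Y.
have phi0 x : x \notin S -> phi x = 0 by move=> /negPf xS; rewrite /phi /negpart xS.
have Ephi : energy e phi <= 2 * mu * sqnorm phi by exact: negpart_energy.
have [|/existsPn harm] := boolP [exists x in S, lap e phi x != mu * phi x].
  case/existsP => x /andP [xS ne]; have [g gE gphi] := strict_perturbation Ephi ne.
  exists g => // y yS; rewrite gphi ?phi0 //; by apply: contraNneq yS => ->.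
have {}harm x : x \in S -> lap e phi x = mu * phi x.
  by move=> xS; have := harm x; rewrite xS /= negbK => /eqP.
have zero_spread x y : x \in S -> phi x = 0 -> e x y -> phi y = 0.
  move=> xS px xy; apply: zero_neighbours (harm x xS) px _ _ xy => u _.
  exact: negpart_ge0.
have neigh y : e z y -> 0 <= Y y \/ (y \in S /\ Y y < 0).
  move=> zy; have [yS|yS] := boolP (y \in S); last by left; exact: bdY zS zy yS.
  by case: (leP 0 (Y y)); [left | right].
have [|phiz] := eqVneq (phi z) 0.
  (* A zero of [phi] at [z] spreads over the connected set [S], so [Y] is nonnegative on [S] and on
     its neighbours; then [z] is not a characteristic point. *)
  move=> phiz; exfalso.
  have all0 x : x \in S -> phi x = 0.
    move=> xS; have /connectP [p pp ->] := Sconn z x zS xS.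
    elim: p z zS phiz pp {chz neigh} => //= y p IHp z zS phiz /andP [/and3P [zy _ yS] pp].
    by apply: IHp yS _ pp; exact: zero_spread zS phiz zy.
  have pos x : x \in S -> 0 <= Y x.
    move=> xS; rewrite leNgt; apply/negP => Yx; have := all0 x xS.
    by rewrite /phi negpart_gt0 // => /eqP; rewrite oppr_eq0 lt_eqF.
  have {}neigh y : e z y -> 0 <= Y y.
    by case/neigh => // -[yS]; rewrite ltNge pos.
  case: chz => [[Yz [u zu /eqP]]|[w zw]]; last first.
    by rewrite ltNge (mulr_ge0 (pos z zS) (neigh w zw)).
  by apply; exact: zero_neighbours (YE z) Yz neigh _ zu.
have [_ Yz] := negpart_neq0 phiz.
have [w zw Yw] : exists2 w, e z w & 0 < Y w.
  case: chz => [[Yz0]|[w zw h]]; first by move: Yz; rewrite Yz0 ltxx.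
  by exists w => //; rewrite ltNge; apply/negP => ?; nra.
have phiw : phi w = 0.
  rewrite /phi /negpart; case: ifP => // _; apply/max_idPr.
  by rewrite oppr_le0 ltW.
(* Inside [S], the zero of [phi] at [w] would spread back to [z]. *)
have [wS|wS] := boolP (w \in S).
  by case/eqP: phiz; apply: zero_spread wS phiw _; rewrite sym_e.
(* Outside [S], replacing the positive value [Y w] by 0 makes [lap] at [z] strictly smaller than the
   equation requires. *)
exfalso; have := harm z zS; apply/eqP; rewrite lt_eqF //.
rewrite /phi (negpart_gt0 zS Yz) mulrN -YE -lapN.
rewrite /lap (bigD1 w) //= [ltRHS](bigD1 w) //=.
apply: ltr_leD.
  by rewrite (phiw : negpart S Y w = 0) (negpart_gt0 zS Yz) ltrD2l ltrN2 oppr_lt0.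
apply: ler_sum => y /andP [zy _]; rewrite (negpart_gt0 zS Yz) lerD2l lerN2 /negpart.
case: ifP => [_|/negbT yS]; first by rewrite le_max lexx.
by rewrite oppr_le0; exact: bdY zS zy yS.
Qed.

End Variational.

(** * Subtrees and branches *)

Section InducedConnectivity.
Variables (V : finType) (e : rel V).
Hypothesis sym_e : symmetric e.

Definition relin (U : {set V}) := [rel x y | [&& e x y, x \in U & y \in U]].

(** The empty set counts as connected; the counts of connected sets below all prescribe a member. *)
Definition cset (U : {set V}) :=
  [forall x in U, forall y in U, connect (relin U) x y].

Lemma csetP (U : {set V}) :
  reflect {in U &, forall x y, connect (relin U) x y} (cset U).
Proof.
apply: (iffP forallP) => [h x y xU yU | h x].
  by have /implyP/(_ xU)/forallP/(_ y)/implyP := h x; apply.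
by apply/implyP => xU; apply/forallP => y; apply/implyP; exact: h.
Qed.

Lemma relin_sym U : connect_sym (relin U).
Proof. by apply: sym_connect_sym => x y /=; rewrite sym_e [X in _ && X]andbC. Qed.

Lemma relin_mono (U W : {set V}) x y :
  U \subset W -> connect (relin U) x y -> connect (relin W) x y.
Proof.
move=> /subsetP sUW; apply: connect_sub => a b /and3P [ab aU bU].
by apply: connect1; rewrite /= ab !sUW.
Qed.

Lemma cset_center (U : {set V}) a :
  {in U, forall x, connect (relin U) a x} -> cset U.
Proof.
move=> h; apply/csetP => x y xU yU.
by apply: connect_trans (h y yU); rewrite relin_sym; exact: h.
Qed.

Lemma cset1 x : cset [set x].
Proof. by apply: (@cset_center _ x) => y /set1P ->; exact: connect0. Qed.

Lemma cset_add (U : {set V}) a b : cset U -> a \in U -> e a b -> cset (b |: U).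
Proof.
move=> /csetP cU aU ab; apply: (@cset_center _ a) => x; rewrite in_setU1.
case/orP => [/eqP ->|xU]; last exact: relin_mono (subsetUr _ _) (cU _ _ aU xU).
by apply: connect1; rewrite /= ab !inE aU eqxx orbT.
Qed.

Lemma connect_crossing (r : rel V) (U : {set V}) x y :
  connect r x y -> x \in U -> y \notin U ->
  exists a b, [/\ r a b, a \in U, b \notin U & connect r x a].
Proof.
case/connectP => p pp ->; elim: p x pp => [|z p IHp] x /=; first by move=> _ ->.
case/andP => xz pz xU lp; have [zU|zU] := boolP (z \in U).
  have [a [b [ab aU bU za]]] := IHp z pz zU lp.
  by exists a, b; split=> //; apply: connect_trans za; exact: connect1.
by exists x, z; split=> //; exact: connect0.
Qed.

Lemma cset_crossing (U S : {set V}) x y : cset U ->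
  x \in U -> y \in U -> x \in S -> y \notin S ->
  exists a b, [/\ e a b, a \in U, b \in U & a \in S /\ b \notin S].
Proof.
move=> /csetP cU xU yU xS yS.
have [a [b [/and3P [ab aU bU] aS bS _]]] := connect_crossing (cU _ _ xU yU) xS yS.
by exists a, b.
Qed.

Definition nb_avoid (u w : V) := #|[set U | [&& cset U, u \in U & w \notin U]]|.

End InducedConnectivity.

Section Tree.
Variables (V : finType) (e : rel V).
Hypotheses (sym_e : symmetric e) (irr_e : irreflexive e).
Hypothesis conn_e : forall x y, connect e x y.
Hypothesis acyc_e : forall c : seq V, ucycle e c -> (size c <= 2)%N.

(** A subtree is determined by its vertices: an edge of the tree joining two of them but missing
    from [H.2] would close a cycle with the path between them in [H]. *)
Lemma subtreeP (H : {set V} * {set V * V}) :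
  is_subtree e H <->
  [/\ H.1 != set0, cset e H.1 & H.2 = [set p | relin e H.1 p.1 p.2]].
Proof.
case: H => U F; split=> /= [[sub [/= U0 [sF iF] inF cF _]]|[U0 cU ->]].
  have FS : subrel (fun x y => (x, y) \in F) (relin e U).
    by move=> x y xy; have /andP [xU yU] := inF _ _ xy; rewrite /= sub ?xU.
  split=> //.
    apply/csetP => x y xU yU; apply: connect_sub (cF x y xU yU) => a b ab.
    by apply: connect1; exact: FS.
  apply/setP => -[x y]; rewrite inE /=; apply/idP/idP; first exact: FS.
  case/and3P => xy xU yU; have /connectP [p pp lp] := cF x y xU yU.
  move: pp lp; case/shortenP => q pq uq _ lq.
  have /acyc_e : ucycle e (x :: q).
    rewrite /ucycle uq andbT /= rcons_path -lq sym_e xy andbT.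
    by apply: sub_path pq; exact: sub.
  case: q pq lq {uq} => [|z [|]] //= => [_ yx | pz -> _].
    by move: xy; rewrite yx irr_e.
  by case/andP: pz.
split=> [x y|]; first by rewrite inE => /and3P [].
split=> //=.
- split=> [x y|x]; rewrite !inE /= ?irr_e // sym_e.
  by rewrite [X in _ && X]andbC.
- by move=> x y; rewrite inE => /and3P [_ -> ->].
- move=> x y xU yU; have /csetP/(_ x y xU yU) := cU.
  by apply: connect_sub => a b ab; apply: connect1; rewrite inE.
move=> c /andP [cc uc]; apply: acyc_e; rewrite /ucycle uc andbT.
by apply: sub_cycle cc => x y; rewrite inE => /and3P [].
Qed.

Lemma nb_subtreesE v : nb_subtrees e v = #|[set U | cset e U & v \in U]|.
Proof.
rewrite /nb_subtrees -(@card_in_imset _ _ fst).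
  apply: eq_card => U; rewrite inE; apply/imsetP/andP.
    by case=> H; rewrite inE => /andP [/asboolP/subtreeP [_ cH _] vH] ->.
  case=> cU vU; exists (U, [set p | relin e U p.1 p.2]) => //.
  rewrite inE vU andbT; apply/asboolP/subtreeP; split=> //=.
  by apply/set0Pn; exists v.
move=> [U F] [U' F']; rewrite !inE.
case/andP=> /asboolP/subtreeP /= [_ _ ->] _ /andP [/asboolP/subtreeP /= [_ _ ->] _].
by move=> ->.
Qed.

(** Subtrees containing both vertices are counted on both sides and cancel. *)
Lemma nb_subtrees_ltn u w :
  (nb_subtrees e u < nb_subtrees e w)%N = (nb_avoid e u w < nb_avoid e w u)%N.
Proof.
have E a b : nb_subtrees e a =
    (#|[set U | [&& cset e U, a \in U & b \in U]]| + nb_avoid e a b)%N.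
  rewrite nb_subtreesE -(cardsID [set U : {set V} | b \in U]) /nb_avoid; congr (_ + _)%N.
    by apply: eq_card => U; rewrite !inE -andbA.
  by apply: eq_card => U; rewrite !inE andbC -andbA.
rewrite (E u w) (E w u) [X in (_ < X + _)%N](_ : _ = #|[set U | [&& cset e U, u \in U & w \in U]]|).
  by rewrite ltn_add2l.
by apply: eq_card => U; rewrite !inE; congr (_ && _); rewrite andbC.
Qed.

Definition avoid (u : V) := [rel x y | [&& e x y, x != u & y != u]].

(* For adjacent u and w, the component of w in the tree minus u. *)
Definition side (u w : V) := [set x | connect (avoid u) w x].

Lemma side_self u w : w \in side u w.
Proof. by rewrite inE connect0. Qed.

Lemma side_notin u w : e u w -> u \notin side u w.
Proof.
move=> uw; rewrite inE; apply/negP => /connectP [p].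
case/lastP: p => [_ /= uEw|p z]; first by move: uw; rewrite {1}uEw irr_e.
by rewrite rcons_path last_rcons => /andP [_ /and3P [_ _ zu]] uz; rewrite -uz eqxx in zu.
Qed.

Lemma side_step u w x y : x \in side u w -> avoid u x y -> y \in side u w.
Proof.
move=> xs xy; move: xs; rewrite !inE => wx.
by apply: connect_trans wx _; apply: connect1.
Qed.

(** A simple path from [w] to [x] avoiding [u], closed up through [u], is a cycle unless it has
    length zero. So the edge between [u] and [w] is the only one leaving the branch. *)
Lemma side_cross u w x y : e u w -> e x y ->
  x \in side u w -> y \notin side u w -> x = w /\ y = u.
Proof.
move=> uw xy xs ys.
have xu : x != u by apply: contraTneq xs => ->; exact: side_notin.
have yu : y = u.
  apply/eqP; apply: contraNT ys => yu; apply: side_step xs _; exact/and3P.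
split=> //; subst y; move: xs; rewrite inE => /connectP [p pp lp].
move: pp lp; case/shortenP => q pq uq _ lq.
have pe : path e w q by apply: sub_path pq => a b /and3P [].
have uNq : u \notin w :: q.
  rewrite inE negb_or; apply/andP; split.
    by apply: contraTneq uw => ->; rewrite irr_e.
  apply/negP => uIq; have := pq; rewrite -[q](cat_take_drop (index u q)) cat_path.
  move=> /andP [_]; rewrite (drop_nth u) ?index_mem // nth_index //=.
  by rewrite eqxx !andbF.
have /acyc_e : ucycle e (u :: w :: q).
  rewrite /ucycle cons_uniq uNq uq /= uw rcons_path pe -lq andbT /=.
  by rewrite xy.
by case: q lq {pq uq pe uNq}.
Qed.

Lemma side_disjoint u w w' : e u w -> e u w' -> w' \in side u w -> w' = w.
Proof.
move=> uw uw' h; rewrite sym_e in uw'.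
by have [] := side_cross uw uw' h (side_notin uw).
Qed.

Lemma side_disjoint_in u w w' x : e u w -> e u w' ->
  x \in side u w -> x \in side u w' -> w = w'.
Proof.
move=> uw uw'; rewrite !inE => wx w'x; apply: side_disjoint uw' uw _.
rewrite inE; apply: connect_trans w'x _.
rewrite (sym_connect_sym (_ : symmetric (avoid u))) // => a b /=.
by rewrite sym_e [X in _ && X]andbC.
Qed.

Lemma side_cover u x : x != u -> exists2 w, e u w & x \in side u w.
Proof.
move=> xu; have /connectP [p pp lp] := conn_e u x.
move: pp lp; case/shortenP => q pq uq _ lq; case: q pq uq lq => /= [_ _ h|w q].
  by rewrite h eqxx in xu.
case/andP=> uw pq /andP [uNq _] lq; exists w => //; rewrite inE.
apply/connectP; exists q => //; elim: q w pq uNq {uw lq} => //= z q IHq w.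
case/andP=> wz pz; rewrite !inE !negb_or => /and3P [uw uz uq].
by rewrite wz eq_sym uw eq_sym uz IHq // !inE negb_or uz uq.
Qed.

(** A connected set containing [u] but not [w] cannot enter the branch of [w], so it consists of [u]
    and some of the other vertices outside that branch. *)
Lemma nb_avoid_le u w : e u w -> (nb_avoid e u w <= 2 ^ #|~: side u w|.-1)%N.
Proof.
move=> uw; have uA : u \in ~: side u w by rewrite inE side_notin.
have -> : (#|~: side u w|.-1 = #|(~: side u w) :\ u|)%N.
  by rewrite (cardsD1 u (~: side u w)) uA.
rewrite -card_powerset /nb_avoid.
rewrite -[X in (X <= _)%N](@card_in_imset _ _ (fun U : {set V} => U :\ u)).
  apply/subset_leq_card/subsetP => _ /imsetP [U + ->].
  rewrite !inE => /and3P [cU uU wU]; apply: setSD; apply/subsetP => x xU.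
  rewrite inE; apply/negP => xs.
  have [a [b [ab aU _ [aS bS]]]] := cset_crossing cU xU uU xs (side_notin uw).
  by have [aw _] := side_cross uw ab aS bS; rewrite -aw aU in wU.
move=> U U'; rewrite !inE => /and3P [_ uU _] /and3P [_ uU' _] E.
by rewrite -(setD1K uU) E setD1K.
Qed.

Lemma side_chain u w k : e u w -> (k < #|side u w|)%N ->
  exists U : {set V}, [/\ cset e U, w \in U, U \subset side u w & #|U| = k.+1].
Proof.
move=> uw; elim: k => [|k IHk] lk.
  exists [set w]; split; rewrite ?cset1 ?inE ?eqxx ?cards1 //.
  by rewrite sub1set side_self.
have [U [cU wU sU szU]] := IHk (ltnW lk).
have /subsetPn [x xs xU] : ~~ (side u w \subset U).
  by apply: contraL lk => /subset_leq_card; rewrite szU -ltnNge ltnS.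
have := xs; rewrite inE => wx.
have [a [b [ab aU bU _]]] := connect_crossing wx wU xU.
exists (b |: U); split.
- by apply: cset_add cU aU _; case/and3P: ab.
- by rewrite !inE wU orbT.
- rewrite subUset sub1set sU andbT; apply: side_step ab.
  exact: (subsetP sU).
by rewrite cardsU1 bU szU.
Qed.

(** Growing from [w] one vertex at a time, the branch contains a connected set through [w] of every
    size from 1 to its cardinality. *)
Lemma nb_avoid_ge u w : e u w -> (#|side u w| <= nb_avoid e w u)%N.
Proof.
move=> uw; have H (k : 'I_#|side u w|) := side_chain uw (ltn_ord k).
have [F FP] := fin_all_exists H.
have Finj : injective F.
  move=> i j E; apply: val_inj; have [_ _ _] := FP i; have [_ _ _] := FP j.
  by rewrite E => -> [].
rewrite -[X in (X <= _)%N]card_ord -(card_imset _ Finj).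
apply/subset_leq_card/subsetP => _ /imsetP [i _ ->]; have [cU wU sU _] := FP i.
rewrite inE cU wU /=; apply: contra (side_notin uw); exact: (subsetP sU).
Qed.

End Tree.

Lemma sum_ord_ltn (m j : nat) : (\sum_(i < m) (i < j)%N = minn m j)%N.
Proof.
elim: m => [|m IHm]; first by rewrite big_ord0 min0n.
rewrite big_ord_recr /= IHm; lia.
Qed.

(** * Nested branches along a geodesic *)

Section Geodesic.
Variables (V : finType) (e : rel V).
Hypotheses (sym_e : symmetric e) (irr_e : irreflexive e).
Hypothesis conn_e : forall x y, connect e x y.
Hypothesis acyc_e : forall c : seq V, ucycle e c -> (size c <= 2)%N.
Variables (d : nat) (vs : nat -> V).
Hypothesis vs_edge : forall i, (i < d)%N -> e (vs i) (vs i.+1).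
Hypothesis vs_inj : forall i j, (i <= d)%N -> (j <= d)%N -> vs i = vs j -> i = j.

Local Notation sd i := (side e (vs i) (vs i.+1)).

Lemma vs_neq i j : (i <= d)%N -> (j <= d)%N -> i != j -> vs i != vs j.
Proof. by move=> id jd; apply: contraNneq => /vs_inj ->. Qed.

Lemma vs_in i j : (i < j <= d)%N -> vs j \in sd i.
Proof.
elim: j => // j IHj; rewrite ltnS leq_eqVlt => /andP [/orP [/eqP ->|ij] jd].
  exact: side_self.
apply: side_step (IHj _) _; first by rewrite ij ltnW.
by rewrite /= vs_edge // !vs_neq //; lia.
Qed.

Lemma vs_notin i j : (j <= i < d)%N -> vs j \notin sd i.
Proof.
move=> /andP [ji id]; rewrite -(subKn ji).
elim: (i - j)%N (leq_subr j i) => [|k IHk] ki.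
  by rewrite subn0; exact: side_notin (vs_edge id).
apply/negP => h; have := IHk (ltnW ki); have -> : (i - k = (i - k.+1).+1)%N by lia.
move=> h'; have E : e (vs (i - k.+1)) (vs (i - k.+1).+1) by apply: vs_edge; lia.
have [/vs_inj] := side_cross irr_e acyc_e (vs_edge id) E h h'.
by move=> H _; have := H _ _; lia.
Qed.

(** A path inside the later branch that left the earlier one would have to reach [vs i], which lies
    outside the later branch. *)
Lemma sd_sub i j : (i <= j < d)%N -> sd j \subset sd i.
Proof.
move=> /andP [ij jd]; apply/subsetP => x xj; have := xj; rewrite inE => jx.
have id := leq_ltn_trans ij jd.
apply/negPn/negP => xi; have ji : vs j.+1 \in sd i by apply: vs_in; lia.
have [a [b [ab ai bi ja]]] := connect_crossing jx ji xi.
have eab : e a b by case/and3P: ab.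
have [_ bE] := side_cross irr_e acyc_e (vs_edge id) eab ai bi.
have : b \in sd j by apply: side_step ab; rewrite inE.
by rewrite bE; apply/negP; apply: vs_notin; lia.
Qed.

(** Each step along the geodesic drops at least the vertex [vs j.+1] from the branch. *)
Lemma card_sd j : (j < d)%N -> (#|sd j| + j <= #|sd 0%N|)%N.
Proof.
elim: j => [|j IHj] jd; first by rewrite addn0.
apply: leq_trans (IHj (ltnW jd)); rewrite addnS -addSn leq_add2r.
apply: proper_card; apply/properP; split; first by apply: sd_sub; lia.
by exists (vs j.+1); [apply: vs_in | apply: vs_notin]; lia.
Qed.

(* The index of the vertex of the geodesic at which x is attached to it. *)
Definition height (x : V) : nat := \sum_(i < d) (x \in sd i).

Lemma height_vs j : (j <= d)%N -> height (vs j) = j.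
Proof.
move=> jd; rewrite /height (eq_bigr (fun i : 'I_d => (i < j)%N : nat)).
  by rewrite sum_ord_ltn; lia.
move=> i _; have id := ltn_ord i; have [ij|ji] := ltnP i j.
  by rewrite vs_in // ij.
by rewrite (negPf (vs_notin _)) // ji.
Qed.

Lemma height_far x : x \in sd d.-1 -> height x = d.
Proof.
move=> xd; rewrite /height (eq_bigr (fun=> 1%N)) ?sum1_card ?card_ord // => i _.
by rewrite (subsetP (sd_sub _) _ xd) //; have := ltn_ord i; lia.
Qed.

(** A change of height means that some [sd i] contains exactly one end, and only the geodesic edge
    defining [sd i] crosses its border. *)
Lemma height_edge x y : e x y -> height x != height y ->
  exists i : 'I_d, (x = vs i /\ y = vs i.+1) \/ (x = vs i.+1 /\ y = vs i).
Proof.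
move=> xy hxy; have [|nex] := boolP [exists i : 'I_d, (x \in sd i) != (y \in sd i)].
  case/existsP => i ni; exists i; have id := vs_edge (ltn_ord i).
  move: ni; have [xi|xi] := boolP (x \in sd i); have [yi|yi] := boolP (y \in sd i) => // _.
    by have [-> ->] := side_cross irr_e acyc_e id xy xi yi; right.
  by rewrite sym_e in xy; have [-> ->] := side_cross irr_e acyc_e id xy yi xi; left.
case/eqP: hxy; apply: eq_bigr => i _.
by move/existsPn: nex => /(_ i); rewrite negbK => /eqP ->.
Qed.

End Geodesic.

(** Evaluates the total of a charge that puts the weight [c k] on the ordered pair
    [(al k, be k)]. *)
Lemma sum_delta2 (R : realType) (V K : finType) (P : pred K) (al be : K -> V)
    (c : K -> R) :
  \sum_x \sum_y \sum_(k | P k) ((x == al k) && (y == be k))%:R * c k =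
  \sum_(k | P k) c k.
Proof.
under eq_bigr do rewrite exchange_big /=.
rewrite exchange_big /=; apply: eq_bigr => k _.
rewrite (bigD1 (al k)) //= (bigD1 (be k)) //= !eqxx mul1r !big1 ?addr0 //.
  move=> x /negPf xk; rewrite big1 // => y _; by rewrite xk mul0r.
by move=> y /negPf yk; rewrite yk mul0r.
Qed.

Lemma energy_le (R : realType) (V : finType) (e : rel V) (f : V -> R)
    (T : V -> V -> R) :
  (forall x y, 0 <= T x y) ->
  (forall x y, e x y -> (f x - f y) ^+ 2 <= T x y + T y x) ->
  energy e f <= 2 * \sum_x \sum_y T x y.
Proof.
move=> T0 fT; rewrite mulr_natl mulr2n [X in _ + X]exchange_big -big_split /=.
apply: ler_sum => x _; rewrite -big_split big_mkcond /=; apply: ler_sum => y _.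
by case: ifP => [/fT //|_]; rewrite addr_ge0.
Qed.

(** * Comparison on the core side *)

Section BranchComparison.
Variables (R : realType) (V : finType) (e : rel V).
Hypotheses (sym_e : symmetric e) (irr_e : irreflexive e).
Hypothesis conn_e : forall x y, connect e x y.
Hypothesis acyc_e : forall c : seq V, ucycle e c -> (size c <= 2)%N.
Variables (d : nat) (vs : nat -> V).
Hypothesis d_gt0 : (0 < d)%N.
Hypothesis vs_edge : forall i, (i < d)%N -> e (vs i) (vs i.+1).
Hypothesis vs_inj : forall i j, (i <= d)%N -> (j <= d)%N -> vs i = vs j -> i = j.

Local Notation sd i := (side e (vs i) (vs i.+1)).
Local Notation h := (height e d vs).
Local Notation v := (vs 0%N).

Lemma card_subset_exact (T : finType) (A : {set T}) k : (k <= #|A|)%N ->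
  exists2 M : {set T}, M \subset A & #|M| = k.
Proof.
move=> kA; exists [set x in take k (enum A)].
  by apply/subsetP => x; rewrite inE => /mem_take; rewrite mem_enum.
rewrite cardsE; have /card_uniqP -> := take_uniq k (enum_uniq A).
by rewrite size_takel // -cardE.
Qed.

(* If v has at most g branches away from vs 1 they are all taken, otherwise
   any g of them. *)
Lemma branch_choice g : (g < #|~: sd 0%N|)%N ->
  exists2 M : {set V}, {in M, forall w, e v w && (w != vs 1%N)} &
    (#|M| <= g <= #|\bigcup_(w in M) side e v w|)%N.
Proof.
move=> gA; pose N := [set w | e v w & w != vs 1%N].
have NP w : w \in N -> e v w && (w != vs 1%N) by rewrite inE.
have [Ng|gN] := leqP #|N| g.
  exists N => //; rewrite Ng /=.
  have : (~: sd 0%N) :\ v \subset \bigcup_(w in N) side e v w.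
    apply/subsetP => x; rewrite !inE => /andP [xv x0].
    have [w vw xw] := side_cover conn_e xv; apply/bigcupP; exists w => //.
    rewrite inE vw; apply: contraNneq x0 => w1; by move: xw; rewrite w1 inE.
  move/subset_leq_card; apply: leq_trans.
  by move: gA; rewrite (cardsD1 v) inE side_notin ?vs_edge.
have [M MN cM] := card_subset_exact (ltnW gN).
exists M => [w /(subsetP MN)/NP //|]; rewrite cM leqnn -{1}cM.
apply/subset_leq_card/subsetP => w wM; apply/bigcupP; exists w => //.
exact: side_self.
Qed.

(** The test function is [t] on the chosen branches and [a] of the height elsewhere. At most [g]
    branch edges at [v] and the [d] geodesic edges carry its energy, while the branches have at
    least [g] vertices to carry [t]. *)
Lemma branch_comparison (mu : R) (g : nat) (t : R) (a : nat -> R) :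
  0 <= mu ->
  (forall phi : V -> R, (forall x, x \in sd d.-1 -> phi x = 0) ->
     2 * mu * sqnorm phi <= energy e phi) ->
  (g < #|~: sd 0%N|)%N -> a d = 0 ->
  mu * (g%:R * t ^+ 2 + \sum_(i < d) a i ^+ 2) <=
  g%:R * (t - a 0%N) ^+ 2 + \sum_(i < d) (a i - a i.+1) ^+ 2.
Proof.
move=> mu0 gapC gA ad; have [M MP /andP [Mg gW]] := branch_choice gA.
set W := \bigcup_(w in M) _ in gW.
have WP x : x \in W -> exists w, [/\ w \in M, e v w, w != vs 1%N & x \in side e v w].
  by case/bigcupP => w wM xw; exists w; have /andP [] := MP w wM.
have Wnear x : x \in W -> x \notin sd 0%N.
  case/WP => w [_ vw w1 xw]; apply: contraNN w1 => x0; apply/eqP.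
  exact: side_disjoint_in sym_e irr_e acyc_e _ _ _ _ vw (vs_edge d_gt0) xw x0.
have vsW i : (i <= d)%N -> vs i \notin W.
  move=> id; apply/negP => iW; have := Wnear _ iW.
  case: i id iW => [_ |i id _]; last by rewrite (vs_in vs_edge vs_inj).
  case/WP => w [_ vw _]; by rewrite (negPf (side_notin irr_e vw)).
pose phi x := if x \in W then t else a (h x).
have phi0 x : x \in sd d.-1 -> phi x = 0.
  move=> xd; rewrite /phi ifN; first by rewrite (height_far irr_e acyc_e vs_edge vs_inj).
  apply: contraTN xd => /Wnear; apply: contra.
  by apply/subsetP/(sd_sub irr_e acyc_e vs_edge vs_inj); lia.
have phivs i : (i <= d)%N -> phi (vs i) = a i.
  by move=> id; rewrite /phi (negPf (vsW _ id)) (height_vs irr_e acyc_e vs_edge vs_inj).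
(* [T1] charges the edges joining the chosen branches to [v], and [T2] those of the geodesic. *)
pose T1 x y := \sum_(w in M) ((x == w) && (y == v))%:R * (t - a 0%N) ^+ 2.
pose T2 x y := \sum_(i < d) ((x == vs i) && (y == vs i.+1))%:R * (a i - a i.+1) ^+ 2.
have T10 x y : 0 <= T1 x y.
  by apply: sumr_ge0 => w _; rewrite mulr_ge0 ?ler0n ?sqr_ge0.
have T20 x y : 0 <= T2 x y.
  by apply: sumr_ge0 => w _; rewrite mulr_ge0 ?ler0n ?sqr_ge0.
have crossW x y : x \in W -> y \notin W -> e x y -> (phi x - phi y) ^+ 2 <= T1 x y.
  move=> xW yW xy; have [w [wM vw w1 xw]] := WP x xW.
  have yw : y \notin side e v w by apply: contra yW => yw; apply/bigcupP; exists w.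
  have [xE yE] := side_cross irr_e acyc_e vw xy xw yw.
  rewrite {1}/phi xW yE phivs // /T1 (bigD1 w) //= xE !eqxx mul1r lerDl.
  by apply: sumr_ge0 => ? _; rewrite mulr_ge0 ?ler0n ?sqr_ge0.
have edgeT2 (i : 'I_d) : (phi (vs i) - phi (vs i.+1)) ^+ 2 <= T2 (vs i) (vs i.+1).
  have id := ltn_ord i.
  rewrite !phivs ?(ltnW id) // /T2 (bigD1 i) //= !eqxx mul1r lerDl.
  by apply: sumr_ge0 => ? _; rewrite mulr_ge0 ?ler0n ?sqr_ge0.
have En : energy e phi <= 2 * \sum_x \sum_y (T1 x y + T2 x y).
  apply: energy_le => [x y|x y xy]; first exact: addr_ge0.
  have H1 := T10 x y; have H2 := T10 y x; have H3 := T20 x y; have H4 := T20 y x.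
  have sq_sym : (phi x - phi y) ^+ 2 = (phi y - phi x) ^+ 2 by ring.
  have [xW|xW] := boolP (x \in W); have [yW|yW] := boolP (y \in W).
  - by rewrite /phi xW yW subrr expr0n !addr_ge0.
  - by have := crossW x y xW yW xy; lra.
  - by rewrite sym_e in xy; have := crossW y x yW xW xy; lra.
  have [hxy|/(height_edge sym_e irr_e acyc_e vs_edge xy)] := eqVneq (h x) (h y).
    by rewrite /phi (negPf xW) (negPf yW) hxy subrr expr0n !addr_ge0.
  move=> [i [[xE yE]|[xE yE]]]; have := edgeT2 i; rewrite -xE -yE; lra.
have sumT : \sum_x \sum_y (T1 x y + T2 x y) =
    #|M|%:R * (t - a 0%N) ^+ 2 + \sum_(i < d) (a i - a i.+1) ^+ 2.
  under eq_bigr do rewrite big_split /=.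
  rewrite big_split /= !sum_delta2; congr (_ + _).
  by rewrite sumr_const mulr_natl.
(* The branches and the vertices [vs i] with [i < d] are disjoint; the squares at all other vertices
   are dropped. *)
have sqb : g%:R * t ^+ 2 + \sum_(i < d) a i ^+ 2 <= sqnorm phi.
  rewrite /sqnorm (bigID (mem W)) /=; apply: lerD.
    rewrite (eq_bigr (fun=> t ^+ 2)) => [|x xW]; last by rewrite /phi xW.
    by rewrite sumr_const -[leRHS]mulr_natl ler_wpM2r ?sqr_ge0 // ler_nat.
  rewrite (bigID (mem [set vs i | i : 'I_d])) /= ler_wpDr //.
    by apply: sumr_ge0 => x _; exact: sqr_ge0.
  rewrite (eq_bigl (mem [set vs i | i : 'I_d])) => [|x]; last first.
    rewrite inE andbC; case: imsetP => //= -[i _ ->].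
    by rewrite vsW // ltnW.
  rewrite big_imset => [|i j _ _ /vs_inj ij]; last first.
    by apply/val_inj/ij; rewrite ltnW.
  by apply: ler_sum => i _; rewrite phivs // ltnW.
have := gapC phi phi0; rewrite -mulrA => gp.
have {}En := le_trans gp En; rewrite ler_pM2l // sumT in En.
apply: le_trans (ler_wpM2l mu0 sqb) (le_trans En _).
by rewrite lerD2r ler_wpM2r ?sqr_ge0 // ler_nat.
Qed.

End BranchComparison.

(** * Rearrangement along a path *)

Lemma energy_ge (R : realType) (V : finType) (e : rel V) (f : V -> R)
    (T : V -> V -> R) : symmetric e ->
  (forall x y, e x y -> T x y + T y x <= (f x - f y) ^+ 2) ->
  2 * (\sum_x \sum_(y | e x y) T x y) <= energy e f.
Proof.
move=> sym_e fT; rewrite mulr_natl mulr2n {2}(exchange_big_dep predT) //=.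
rewrite -big_split /=; apply: ler_sum => x _.
under [X in _ + X]eq_bigl do rewrite sym_e.
by rewrite -big_split /=; apply: ler_sum => y; exact: fT.
Qed.

Section Rearrangement.
Variables (R : realType) (V : finType) (e : rel V).
Hypothesis sym_e : symmetric e.
Hypothesis conn_e : forall x y, connect e x y.
Variable f : V -> R.

Let s := sort >=%R [seq f x | x <- enum V].

(** The decreasing rearrangement of [f], with the default value 0 from index [#|V|] on. *)
Definition rearr (k : nat) : R := s`_k.

Let size_s : size s = #|V|.
Proof. by rewrite size_sort size_map -cardE. Qed.

Lemma rearr_sum (G : R -> R) : \sum_(k < #|V|) G (rearr k) = \sum_x G (f x).
Proof.
rewrite -size_s -(big_mkord xpredT (fun k => G (rearr k))) -(big_nth 0 xpredT G).
have /(perm_big _) -> : perm_eq s [seq f x | x <- enum V] by rewrite perm_sort.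
by rewrite big_map big_enum.
Qed.

Lemma rearr_le i j : (i <= j < #|V|)%N -> rearr j <= rearr i.
Proof.
move=> /andP [ij jV]; have ss : sorted >=%R s by apply: sort_sorted => ? ?; exact: le_total.
have tr : transitive (>=%R : rel R) by move=> a b c ab bc; exact: le_trans bc ab.
have := sorted_leq_nth tr (@lexx _ R) 0 ss; apply; rewrite ?inE ?size_s //.
exact: leq_ltn_trans ij jV.
Qed.

Lemma rearr_attained k : (k < #|V|)%N -> exists x, f x = rearr k.
Proof.
rewrite -size_s => /(mem_nth 0); rewrite mem_sort => /mapP [x _ xE].
by exists x.
Qed.

Lemma rearr_index x : exists2 k, (k < #|V|)%N & f x = rearr k.
Proof.
have : f x \in s by rewrite mem_sort map_f // mem_enum.
by case/(nthP 0) => k; rewrite size_s => kV <-; exists k.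
Qed.

Lemma rearr_next x k : (k.+1 < #|V|)%N -> f x < rearr k -> f x <= rearr k.+1.
Proof.
move=> kV; have [j jV ->] := rearr_index x; have [jk|kj] := leqP j k.
  by rewrite ltNge (@rearr_le j k) // jk ltnW.
by rewrite rearr_le // kj.
Qed.

(** A discrete Polya-Szego inequality. By connectedness every gap between consecutive values is
    crossed by some edge; an edge crossing several gaps spans at least their sum, whose square
    dominates the sum of their squares. *)
Lemma rearr_energy :
  2 * \sum_(k < #|V|.-1) (rearr k - rearr k.+1) ^+ 2 <= energy e f.
Proof.
(* [c k x y] indicates that [f] falls across the whole [k]-th gap from [x] to [y]. *)
pose c k x y : R := [&& rearr k.+1 < rearr k, f y <= rearr k.+1 & rearr k <= f x]%:R.
pose T x y := \sum_(k < #|V|.-1) c k x y * (rearr k - rearr k.+1) ^+ 2.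
have c01 k x y : 0 <= c k x y by exact: ler0n.
have kV (k : 'I_#|V|.-1) : (k.+1 < #|V|)%N by have := ltn_ord k; lia.
have Tle x y : f y <= f x -> T x y <= (f x - f y) ^+ 2.
  move=> yx; set dl := f x - f y; have dl0 : 0 <= dl by rewrite subr_ge0.
  (* Truncation to the interval from [f y] to [f x] leaves the crossed gaps unchanged, and the
     truncated gaps telescope to at most [dl]. *)
  pose clip z := Num.max (f y) (Num.min (f x) z).
  have clip_mono : {homo clip : a b / a <= b}.
    move=> a b ab; rewrite /clip ge_max !le_max lexx /=; apply/orP; right.
    by rewrite le_min !ge_min lexx ab orbT.
  apply: le_trans (_ : dl * \sum_(k < #|V|.-1) (clip (rearr k) - clip (rearr k.+1)) <= _).
    rewrite mulr_sumr; apply: ler_sum => k _.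
    rewrite /c; case: and3P => [[h1 h2 h3]|_]; last first.
      by rewrite mul0r mulr_ge0 // subr_ge0 clip_mono // rearr_le // leqnSn kV.
    rewrite mul1r /clip !(min_idPr _) //; last by rewrite (le_trans _ h3) // ltW.
    rewrite !(max_idPr _) //; last by rewrite (le_trans h2) // ltW.
    by rewrite expr2 ler_wpM2r ?subr_ge0 ?(ltW h1) // /dl lerB.
  rewrite expr2 ler_wpM2l //.
  rewrite -(big_mkord xpredT (fun k => clip (rearr k) - clip (rearr k.+1))).
  rewrite (eq_bigr (fun k => (- clip (rearr k.+1)) - (- clip (rearr k)))) => [|k _].
    rewrite (telescope_sumr (fun k => - clip (rearr k))) // opprK addrC /dl lerB //.
      by rewrite /clip ge_max yx ge_min lexx.
    by rewrite /clip le_max lexx.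
  by rewrite opprK addrC.
have T0 x y : f y <= f x -> T y x = 0.
  move=> yx; apply: big1 => k _; rewrite /c; case: and3P => [[h1 h2 h3]|]; rewrite ?mul0r //.
  by move: (lt_le_trans (le_lt_trans h2 h1) h3); rewrite ltNge yx.
apply: le_trans (energy_ge sym_e (T := T) _); last first.
  move=> x y _; have [yx|/ltW xy] := leP (f y) (f x).
    by rewrite (T0 x y) // addr0 Tle.
  by rewrite (T0 y x) // add0r -sqrrN opprB Tle.
rewrite ler_pM2l //.
rewrite /T; under [leRHS]eq_bigr do rewrite exchange_big /=.
rewrite [leRHS]exchange_big /=; apply: ler_sum => k _.
have [h|hk] := boolP (rearr k == rearr k.+1).
  rewrite (eqP h) subrr expr0n /=; apply: sumr_ge0 => x _; apply: sumr_ge0 => y _.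
  by rewrite mulr0.
have lk : rearr k.+1 < rearr k.
  by rewrite lt_def hk rearr_le // leqnSn kV.
have [x xE] := rearr_attained (ltnW (kV k)); have [y yE] := rearr_attained (kV k).
(* A path from a point of value [rearr k] to one of value [rearr k.+1] leaves the upper level set
   along an edge; no value lies strictly inside the gap, so that edge crosses all of it. *)
have := connect_crossing (U := [set z | rearr k <= f z]) (conn_e x y).
rewrite !inE xE yE lexx -ltNge => /(_ isT lk) [a [b [ab]]].
rewrite !inE -ltNge => ka bk _.
apply: le_trans (_ : c k a b * (rearr k - rearr k.+1) ^+ 2 <= _).
  by rewrite /c lk ka rearr_next ?mul1r.
rewrite (bigD1 a) //= (bigD1 b) //= -addrA lerDl addr_ge0 ?sumr_ge0 //.
  by move=> ? _; rewrite mulr_ge0 ?sqr_ge0.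
by move=> ? _; apply: sumr_ge0 => ? _; rewrite mulr_ge0 ?sqr_ge0.
Qed.

Hypothesis f_ge0 : forall x, 0 <= f x.

Lemma rearr_ge0 k : 0 <= rearr k.
Proof.
have [kV|kV] := ltnP k #|V|; first by have [x <-] := rearr_attained kV.
by rewrite /rearr nth_default // size_s.
Qed.

(** If [rearr k] were positive, so would be the [k] values before it, giving [k.+1] points of
    [B]. *)
Lemma rearr_eq0 (B : {set V}) k :
  (forall x, x \notin B -> f x = 0) -> (#|B| <= k)%N -> rearr k = 0.
Proof.
move=> fB Bk; have [kV|kV] := ltnP k #|V|; last by rewrite /rearr nth_default ?size_s.
apply/eqP; apply: contraTT Bk => rk; rewrite -ltnNge.
have rk0 : 0 < rearr k by rewrite lt_def rk rearr_ge0.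
pose pos (z : R) := 0 < z; apply: leq_trans (_ : count pos s <= _)%N.
  rewrite -[s](cat_take_drop k.+1) count_cat.
  have : all pos (take k.+1 s).
    apply/(all_nthP 0) => i; rewrite size_takel ?size_s // => ik.
    by rewrite nth_take //; apply: lt_le_trans rk0 _; apply: rearr_le; lia.
  by rewrite all_count => /eqP ->; rewrite size_takel ?size_s // leq_addr.
have /seq.permP -> : perm_eq s [seq f x | x <- enum V] by rewrite perm_sort.
rewrite count_map -size_filter.
have -> : size [seq x <- enum V | preim f pos x] = #|[set x | pos (f x)]|.
  rewrite -(card_uniqP (filter_uniq _ (enum_uniq V))); apply: eq_card => x.
  by rewrite mem_filter mem_enum inE andbT.
apply/subset_leq_card/subsetP => x; rewrite inE => fx.
by apply: contraTT fx => /fB ->; rewrite /pos ltxx.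
Qed.

End Rearrangement.

(** * Path-stars *)

Section PathStar.
Variables (n g : nat).
Hypotheses (g_ge2 : (2 <= g)%N) (g_le : (g + 3 <= n)%N).

Local Notation m := (n - g)%N.
Local Notation e := (@path_star n g).

(** Roots the path-star at the end 0 of its path, so that every other vertex has exactly one smaller
    neighbour. The value at 0 is always guarded by positivity. *)
Definition parent (b : nat) : nat := if (b < m)%N then b.-1 else m.-1.

Lemma path_starE (x y : 'I_n) : e x y =
  ((0 < y) && (x == parent y :> nat) || (0 < x) && (y == parent x :> nat))%N.
Proof.
rewrite /path_star /parent; congr (_ || _).
  by case: ifP => h; apply/idP/idP; lia.
by case: ifP => h; apply/idP/idP; lia.
Qed.

Lemma parent_lt (b : nat) : (0 < b)%N -> (parent b < b)%N.
Proof. by rewrite /parent; case: ifP; lia. Qed.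

Lemma path_star_sym : symmetric e.
Proof. by move=> x y; rewrite !path_starE orbC. Qed.

Lemma path_star_irr : irreflexive e.
Proof.
move=> x; rewrite path_starE orbb; apply/negP => /andP [x0 /eqP h].
by have := parent_lt x0; rewrite -h ltnn.
Qed.

Lemma path_star_down (x y : 'I_n) : e x y -> (y <= x)%N -> y = parent x :> nat.
Proof.
rewrite path_starE => /orP [|] /andP [h /eqP -> //] yx.
by have := parent_lt h; lia.
Qed.

(** The largest vertex of a cycle would have two distinct smaller neighbours, both equal to its
    parent. *)
Lemma path_star_acyclic (c : seq 'I_n) : ucycle e c -> (size c <= 2)%N.
Proof.
move=> /andP [cc uc]; rewrite leqNgt; apply/negP => sc.
have [x0 x0c] : exists x, x \in c by case: c sc {cc uc} => // x; exists x; rewrite mem_head.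
case: (@arg_maxnP _ x0 (mem c) (@nat_of_ord n) x0c) => x xc xmax.
have [i q qE] := rot_to xc.
move: cc uc sc; rewrite -(rot_cycle i) -(rot_uniq i) -(size_rot i c) qE => cc uq sq.
have qle z : z \in q -> (z <= x)%N.
  by move=> zq; apply: xmax; have := mem_rot i c z; rewrite qE inE zq orbT inE => <-.
case: q qE cc uq sq qle => [|y q] // qE; case/lastP: q qE => [|q z] // qE.
rewrite /= rcons_path last_rcons => /and3P [xy _ zx] /and3P [_ yq _] _ qle.
have yE := path_star_down xy (qle y (mem_head _ _)).
rewrite path_star_sym in zx.
have zE := path_star_down zx (qle z _); move: yq.
rewrite (_ : y = z) ?mem_rcons ?mem_head //; apply: val_inj => /=.
by rewrite yE zE // inE mem_rcons mem_head orbT.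
Qed.

Lemma path_star_connect (x y : 'I_n) : connect e x y.
Proof.
have n0 : (0 < n)%N by lia.
have H (z : 'I_n) : connect e (Ordinal n0) z.
  case: z => k; elim/ltn_ind: k => -[_ kn|k IHk kn].
    by rewrite (_ : Ordinal n0 = Ordinal kn) ?connect0 //; exact: val_inj.
  have pk : (parent k.+1 < k.+1)%N by exact: parent_lt.
  have pn : (parent k.+1 < n)%N by lia.
  apply: connect_trans (IHk _ pk pn) _; apply: connect1.
  by rewrite path_starE /= eqxx.
apply: connect_trans (H y); rewrite (sym_connect_sym path_star_sym); exact: H.
Qed.

Lemma center_subproof : (m.-1 < n)%N. Proof. lia. Qed.
Definition star_center : 'I_n := Ordinal center_subproof.

Lemma star_cset a (L : {set 'I_n}) : (a < m)%N ->
  {in L, forall x : 'I_n, (m <= x)%N} ->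
  cset e [set x : 'I_n | (a <= x < m)%N || (x \in L)].
Proof.
move=> am Lm; set U := [set x | _].
have cU : star_center \in U by rewrite inE /=; apply/orP; left; lia.
apply: (cset_center path_star_sym (a := star_center)) => x; rewrite inE => /orP [|xL].
  have [k kE] : exists k, (m.-1 - x)%N = k by eexists.
  elim: k x kE => [|k IHk] x xk xa.
    by rewrite (_ : x = star_center) ?connect0 //; apply: val_inj => /=; lia.
  have xn : (x.+1 < n)%N by lia.
  apply: connect_trans (IHk (Ordinal xn) _ _) _ => /=; [lia | lia |].
  apply: connect1; rewrite /= path_starE !inE /= /parent.
  apply/and3P; split; [do 2 case: ifP; lia | apply/orP; left; lia | by rewrite xa].
apply: connect1; rewrite /= cU inE xL orbT !andbT path_starE /parent /=.
by have := Lm x xL; case: ifP; lia.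
Qed.

Lemma star_leaves : #|[set x : 'I_n | (m <= x)%N]| = g.
Proof.
have -> : [set x : 'I_n | (m <= x)%N] = ~: [set x : 'I_n | (x < m)%N].
  by apply/setP => x; rewrite !inE leqNgt.
have mn : (m <= n)%N by exact: leq_subr.
have -> : [set x : 'I_n | (x < m)%N] = [set widen_ord mn i | i : 'I_m].
  apply/setP => x; rewrite inE; apply/idP/imsetP => [xm|[k _ xE]].
    by exists (Ordinal xm) => //; apply: val_inj.
  by rewrite xE /= ltn_ord.
have inj : injective (widen_ord mn) by move=> i j /(congr1 val) /= h; apply: val_inj.
by rewrite cardsCs setCK card_imset // !card_ord; lia.
Qed.

(** The path from [y] to the center may be completed by any set of the [g] leaves. *)
Lemma star_avoid_up (x y : 'I_n) : (x.+1 = y)%N -> (y < m)%N ->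
  (2 ^ g <= nb_avoid e y x)%N.
Proof.
move=> xy ym; rewrite -[X in (2 ^ X <= _)%N]star_leaves -card_powerset.
pose F (L : {set 'I_n}) : {set 'I_n} := [set z : 'I_n | (y <= z < m)%N || (z \in L)].
rewrite -[X in (X <= _)%N](@card_in_imset _ _ F) /=.
  apply/subset_leq_card/subsetP => _ /imsetP [L + ->]; rewrite inE => /subsetP Lm.
  have {}Lm : {in L, forall z : 'I_n, (m <= z)%N} by move=> z /Lm; rewrite inE.
  rewrite inE; apply/and3P; split; first exact: (star_cset ym Lm).
    by rewrite inE leqnn ym.
  rewrite inE negb_or; apply/andP; split; first lia.
  by apply/negP => /Lm; lia.
move=> L L'; rewrite !inE => /subsetP Lm /subsetP Lm' /setP E; apply/setP => z.
have := E z; rewrite !inE; have [zm|mz] := ltnP z m; last by rewrite andbF.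
move=> _; apply/idP/idP => [/Lm|/Lm']; rewrite inE; lia.
Qed.

(** A connected set containing [x] but not [y] is an interval ending at [x], determined by its left
    end, which is less than [m.-1]. *)
Lemma star_avoid_down (x y : 'I_n) : (x.+1 = y)%N -> (y < m)%N ->
  (nb_avoid e x y <= m.-1)%N.
Proof.
move=> xy ym; pose F (a : 'I_m.-1) : {set 'I_n} := [set z : 'I_n | (a <= z <= x)%N].
rewrite -[X in (_ <= X)%N]card_ord -cardsT; apply: leq_trans (leq_imset_card F _).
apply/subset_leq_card/subsetP => U; rewrite inE => /and3P [cU xU yU].
have Ule z : z \in U -> (z <= x)%N.
  move=> zU; rewrite leqNgt; apply/negP => xz.
  have [||a [b [ab aU bU []]]] := cset_crossing (S := [set w : 'I_n | (w <= x)%N]) cU xU zU.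
  - by rewrite inE.
  - by rewrite inE -ltnNge.
  rewrite !inE -ltnNge => ax xb; case/negP: yU.
  rewrite (_ : y = b) //; apply: val_inj => /=.
  move: ab; rewrite path_star_sym => /path_star_down H.
  by have := H _; rewrite /parent; case: ifP; lia.
case: (@arg_minnP _ x (mem U) (@nat_of_ord n) xU) => a aU amin.
have am : (a < m.-1)%N by have := Ule a aU; lia.
apply/imsetP; exists (Ordinal am); rewrite ?inE //; apply/setP => z; rewrite inE /=.
apply/idP/andP => [zU|[az zx]]; first by split; [exact: amin | exact: Ule].
apply/negPn/negP => zU.
have [||a' [b [ab aU' bU []]]] := cset_crossing (S := [set w : 'I_n | (w < z)%N]) cU aU xU.
- by rewrite inE ltn_neqAle az andbT; apply: contraNneq zU => /val_inj <-.
- by rewrite inE -leqNgt.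
rewrite !inE -leqNgt => az' zb; case/negP: zU.
rewrite (_ : z = b) //; apply: val_inj => /=.
move: ab; rewrite path_star_sym => /path_star_down H; have := Ule b bU.
by have := H _; rewrite /parent; case: ifP; lia.
Qed.

Lemma star_leaf_side (x : 'I_n) : (m <= x)%N -> (n.-1 <= #|side e x star_center|)%N.
Proof.
move=> mx; have -> : n.-1 = #|[set~ x]| by rewrite cardsC1 card_ord.
apply/subset_leq_card/subsetP => y; rewrite !inE => yx.
have [w xw] := side_cover path_star_connect yx.
suff -> : w = star_center by rewrite inE.
apply: val_inj => /=; move: xw; rewrite path_starE /parent.
by have := ltn_ord w; do 2 case: ifP; lia.
Qed.

Hypothesis g_large : (n.-1 < 2 ^ g + g)%N.

(** The number of subtrees strictly increases towards the center. From a leaf, one set at most is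
    compared with at least [n.-1]; along the path, at most [m.-1] sets are compared with at least
    [2 ^ g], and [g_large] says that [m.-1] is smaller. *)
Lemma star_core (x : 'I_n) : x \in subtree_core e -> x = star_center.
Proof.
rewrite inE => /forallP/(_ star_center); rewrite leqNgt => nlt.
have lt_nb := nb_subtrees_ltn path_star_sym path_star_irr path_star_acyclic.
apply/eqP; apply: contraNT nlt => xc; have [xm|mx] := ltnP x m; last first.
  have ex : e x star_center.
    by rewrite path_starE /parent /=; do 2 case: ifP; lia.
  have side_x := star_leaf_side mx.
  rewrite lt_nb.
  have := nb_avoid_ge path_star_sym path_star_irr ex.
  have := nb_avoid_le path_star_irr path_star_acyclic ex.
  have -> : (#|~: side e x star_center|.-1 = 0)%N.
    by rewrite cardsCs setCK card_ord; lia.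
  by rewrite expn0; lia.
have {xc} : (x < m.-1)%N.
  by have : (x != m.-1 :> nat)%N by []; lia.
have [k kE] : exists k, (m.-1 - x)%N = k.+1 \/ (m.-1 - x)%N = 0%N.
  by exists (m.-1 - x).-1%N; lia.
case: kE => [kE _|]; last by lia.
have step (z y : 'I_n) : (z.+1 = y)%N -> (y < m)%N ->
    (nb_subtrees e z < nb_subtrees e y)%N.
  move=> zy ym; rewrite lt_nb; apply: leq_ltn_trans (star_avoid_down zy ym) _.
  by apply: leq_trans (star_avoid_up zy ym); lia.
elim: k x kE {xm} => [|k IHk] x xk.
  by apply: step => /=; lia.
have xn : (x.+1 < n)%N by lia.
by apply: ltn_trans (step x (Ordinal xn) _ _) (IHk _ _) => //=; lia.
Qed.

End PathStar.

(** * Distances *)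

Section Distances.

Lemma bigminn_le (I : finType) (P : pred I) (F : I -> nat) x0 i :
  P i -> (\big[minn/x0]_(j | P j) F j <= F i)%N.
Proof.
rewrite unlock; have : i \in index_enum I by exact: mem_index_enum.
elim: (index_enum I) => //= j s IHs; rewrite inE => /orP [/eqP <- ->|/IHs h /h].
  exact: geq_minl.
by case: (P j) => //; apply: leq_trans; exact: geq_minr.
Qed.

Lemma bigminn_attained (I : finType) (P : pred I) (F : I -> nat) x0 :
  \big[minn/x0]_(j | P j) F j = x0 \/
  exists2 i, P i & \big[minn/x0]_(j | P j) F j = F i.
Proof.
elim/big_ind: _ => [|x y hx hy|i Pi]; [by left | | by right; exists i].
by rewrite /minn; case: ifP.
Qed.

Lemma bigminn_ge (I : finType) (P : pred I) (F : I -> nat) x0 k :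
  (k <= x0)%N -> (forall i, P i -> (k <= F i)%N) -> (k <= \big[minn/x0]_(j | P j) F j)%N.
Proof.
by move=> kx kF; elim/big_ind: _ => // x y kx' ky; rewrite leq_min kx'.
Qed.

Variables (V : finType) (e : rel V).

Lemma gdist_le u p : path e u p -> uniq (u :: p) -> (gdist e u (last u p) <= size p)%N.
Proof.
move=> pp up; have sp : (size p < #|V|)%N.
  by have := max_card (mem (u :: p)); rewrite (card_uniqP up).
apply: (@bigminn_le _ _ _ _ (Ordinal sp)); apply/existsP; exists (in_tuple p).
exact/and3P.
Qed.

Lemma gdistP u w : (gdist e u w < #|V|)%N ->
  exists2 p, path e u p /\ uniq (u :: p) & last u p = w /\ size p = gdist e u w.
Proof.
rewrite /gdist.
case: (bigminn_attained (fun k : 'I_#|V| => [exists p : k.-tuple V,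
  [&& path e u p, uniq (u :: p) & last u p == w]]) (@nat_of_ord #|V|) #|V|).
  by move=> ->; rewrite ltnn.
case=> k /existsP [p /and3P [pp up /eqP lp]] -> _.
by exists p; rewrite ?size_tuple.
Qed.

Lemma gdist_lt u w : connect e u w -> (gdist e u w < #|V|)%N.
Proof.
case/connectP => p + lp; move: lp; move=> + pp; case/shortenP: pp => q pq uq _ ->.
apply: leq_ltn_trans (gdist_le pq uq) _.
by have := max_card (mem (u :: q)); rewrite (card_uniqP uq).
Qed.

Lemma set_dist_le (U W : {set V}) u w :
  u \in U -> w \in W -> (set_dist e U W <= gdist e u w)%N.
Proof.
move=> uU wW; apply: leq_trans (bigminn_le _ _ wW).
exact: (@bigminn_le _ (mem U) (fun u => \big[minn/#|V|]_(w in W) gdist e u w)).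
Qed.

Lemma set_dist_ge (U W : {set V}) k : (k <= #|V|)%N ->
  (forall u w, u \in U -> w \in W -> (k <= gdist e u w)%N) -> (k <= set_dist e U W)%N.
Proof.
move=> kV H; apply: bigminn_ge => // u uU; apply: bigminn_ge => // w; exact: H.
Qed.

Lemma set_dist_attained (U W : {set V}) u w : u \in U -> w \in W -> connect e u w ->
  exists u' w', [/\ u' \in U, w' \in W & set_dist e U W = gdist e u' w'].
Proof.
move=> uU wW uw; have := leq_ltn_trans (set_dist_le uU wW) (gdist_lt uw).
rewrite /set_dist.
case: (bigminn_attained (mem U) (fun u => \big[minn/#|V|]_(w in W) gdist e u w) #|V|).
  by move=> ->; rewrite ltnn.
case=> u' u'U ->; case: (bigminn_attained (mem W) (gdist e u') #|V|).
  by move=> ->; rewrite ltnn.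
by case=> w' w'W -> _; exists u', w'.
Qed.

Lemma gdist_walk u w : (gdist e u w < #|V|)%N ->
  exists vs : nat -> V, [/\ vs 0%N = u, vs (gdist e u w) = w,
    forall i, (i < gdist e u w)%N -> e (vs i) (vs i.+1) &
    forall i j, (i <= gdist e u w)%N -> (j <= gdist e u w)%N -> vs i = vs j -> i = j].
Proof.
case/gdistP => p [pp up] [lp sp]; exists (nth u (u :: p)); rewrite -sp; split=> //.
- by rewrite -[LHS]/(nth u (u :: p) (size p)) nth_last.
- by move=> i ip; have /(pathP u) := pp; apply.
by move=> i j ip jp /eqP; rewrite nth_uniq // => /eqP.
Qed.

Lemma gdist_vs (d : nat) (vs : nat -> V) i j :
  (forall i, (i < d)%N -> e (vs i) (vs i.+1)) ->
  (forall i j, (i <= d)%N -> (j <= d)%N -> vs i = vs j -> i = j) ->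
  (i <= j <= d)%N -> (gdist e (vs i) (vs j) <= j - i)%N.
Proof.
move=> ve vi /andP [/subnKC <-]; rewrite addKn; move: (j - i)%N => k ikd.
pose p := [seq vs l | l <- iota i.+1 k].
have E : vs (i + k)%N = last (vs i) p.
  rewrite /p last_map; congr vs.
  by elim: k i {ikd p} => [|k IHk] i; rewrite ?addn0 //= -IHk addnS addSn.
have szp : size p = k by rewrite size_map size_iota.
rewrite E -szp; apply: gdist_le.
  rewrite /p; elim: k i ikd {p E szp} => //= k IHk i ikd.
  by rewrite ve ?IHk //; lia.
rewrite /p -[_ :: _]/[seq vs l | l <- iota i k.+1] map_inj_in_uniq ?iota_uniq //.
by move=> a b; rewrite !mem_iota => ha hb; apply: vi; lia.
Qed.

End Distances.

(** * Vertices covered by the characteristic set *)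

Section CharacteristicSet.
Variables (R : realType) (n : nat) (e : rel 'I_n) (Y : 'cV[R]_n).
Hypothesis sym_e : symmetric e.
Local Notation y := (fun i => Y i 0).

Lemma cover_char_pt w : w \in cover (char_set e Y) -> char_pt e y w.
Proof.
case/bigcupP => A /setUP [] /imsetP [] => [v|[u v] /=].
  case/andP => /eqP Yv /existsP [u /andP [vu Yu]] -> /set1P ->.
  by left; split=> //; exists u.
rewrite inE => /andP [/= uv Yuv] -> /set2P [->|->]; right.
  by exists v.
by exists u; rewrite 1?sym_e // mulrC.
Qed.

Lemma cover_char_edge u w : e u w -> Y u 0 * Y w 0 < 0 -> w \in cover (char_set e Y).
Proof.
move=> uw Yuw; apply/bigcupP; exists [set u; w]; last by rewrite !inE eqxx orbT.
by apply/setUP; right; apply/imsetP; exists (u, w); rewrite // inE /char_edge uw.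
Qed.

Lemma cover_char_vertex u w : e u w -> Y u 0 = 0 -> Y w 0 != 0 ->
  u \in cover (char_set e Y).
Proof.
move=> uw Yu Yw; apply/bigcupP; exists [set u]; last by rewrite inE.
apply/setUP; left; apply/imsetP; exists u => //.
by rewrite unfold_in /char_vertex Yu eqxx; apply/existsP; exists w; rewrite uw.
Qed.

(** As [mu] is nonzero, [Y] has sum zero and takes both signs. A path from a positive to a negative
    vertex leaves the positive set along an edge, whose far end is a characteristic vertex or an end
    of a characteristic edge. *)
Lemma char_set_nonempty mu : (forall x y, connect e x y) -> 0 < mu -> Y != 0 ->
  (forall x, lap e y x = mu * Y x 0) -> exists w, w \in cover (char_set e Y).
Proof.
move=> conn_e mu0 Y0 YE.
have sumY : \sum_x Y x 0 = 0.
  apply/eqP; rewrite -(mulrI_eq0 _ (mulfI (lt0r_neq0 mu0))) mulr_sumr.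
  under eq_bigr do rewrite -YE -[lap _ _ _]mul1r.
  rewrite (sum_lap sym_e (fun=> 1)) big1 // => x _.
  by rewrite /lap big1 ?mul0r // => z _; rewrite subrr.
have key (f : 'I_n -> R) : \sum_x f x = 0 -> (exists x, f x != 0) -> exists x, 0 < f x.
  move=> f0 [x fx]; have [|nex] := boolP [exists x, 0 < f x].
    by case/existsP => z ?; exists z.
  exfalso; move/existsPn: nex => np; case/eqP: fx; apply/eqP.
  have : \sum_x - f x == 0 by rewrite sumrN f0 oppr0.
  rewrite psumr_eq0 => [/allP/(_ x (mem_index_enum _))|z _]; first by rewrite oppr_eq0.
  by rewrite oppr_ge0 leNgt np.
have exY : exists x, Y x 0 != 0.
  have [|nex] := boolP [exists x, Y x 0 != 0]; first by case/existsP => z ?; exists z.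
  case/eqP: Y0; apply/matrixP => i j; rewrite ord1 mxE.
  by move/existsPn: nex => /(_ i); rewrite negbK => /eqP.
have [x Yx] := key _ sumY exY.
have [z Yz] : exists z, 0 < - Y z 0.
  apply: (key (fun z => - Y z 0)); first by rewrite sumrN sumY oppr0.
  by case: exY => z; exists z; rewrite oppr_eq0.
have := connect_crossing (U := [set w | 0 < Y w 0]) (conn_e x z).
rewrite !inE Yx ltNge ltW -?oppr_gt0 // => /(_ isT isT) [a [b [ab]]].
rewrite !inE -leNgt => Ya Yb _; have [Yb0|Yb0] := eqVneq (Y b 0) 0.
  by exists b; apply: (cover_char_vertex (w := a)); rewrite 1?sym_e ?gt_eqF.
by exists b; apply: cover_char_edge ab _; rewrite pmulr_rlt0 // lt_neqAle Yb0.
Qed.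

End CharacteristicSet.

(* What a tree with core-to-characteristic-set distance d hands over to the
   comparison with the path-star: a profile F, the decreasing rearrangement of a
   test function beyond the characteristic set, and a one-dimensional inequality on the core side. *)
Lemma tree_side (R : realType) (n g : nat) (e : rel 'I_n) (Y : 'cV[R]_n) :
  (1 < n)%N ->
  (forall k, (n.-1 < 2 ^ k + k)%N -> (g <= k)%N) ->
  is_tree [set: 'I_n] e -> is_fiedler_vector e Y ->
  (0 < dist_core_char e Y)%N ->
  let d := dist_core_char e Y in
  exists (mu : R) (F : nat -> R),
    [/\ (d + g + 1 < n)%N,
        forall k, (n - g - 1 - d <= k)%N -> F k = 0,
        0 < \sum_(k < n) F k,
        \sum_(k < n.-1) (F k - F k.+1) ^+ 2 <= mu * \sum_(k < n) F k ^+ 2 &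
        forall t (a : nat -> R), a d = 0 ->
          mu * (g%:R * t ^+ 2 + \sum_(i < d) a i ^+ 2) <=
          g%:R * (t - a 0%N) ^+ 2 + \sum_(i < d) (a i - a i.+1) ^+ 2].
Proof.
move=> n1 g_min [_ [sym_e irr_e] _ conn acyc_e] [Y0 [mu mu2 LY]] d_gt0 d.
have {}d_gt0 : (0 < d)%N by [].
have conn_e x y : connect e x y by apply: conn; rewrite inE.
have gap := spectral_gap sym_e irr_e mu2.
have mu0 := fiedler_value_gt0 sym_e irr_e mu2 conn_e.
pose y i := Y i 0.
have YE x : lap e y x = mu * y x by rewrite -laplacian_lap // LY mxE.
have [w0 w0Z] := char_set_nonempty sym_e conn_e mu0 Y0 YE.
set Z := cover (char_set e Y) in w0Z.
have [v0 v0S] : exists v0, v0 \in subtree_core e.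
  have n0 : (0 < n)%N by exact: ltnW.
  case: (@arg_maxnP _ (Ordinal n0) xpredT (nb_subtrees e) isT) => v _ vmax.
  by exists v; rewrite inE; apply/forallP => u; exact: vmax.
have [v [r [vS rZ dE]]] := set_dist_attained v0S w0Z (conn_e v0 w0).
rewrite -[set_dist _ _ _]/d in dE.
have [vs []] := gdist_walk (gdist_lt (conn_e v r)).
rewrite -dE => vs0 vsd vs_edge vs_inj.
pose sd i := side e (vs i) (vs i.+1).
have d1 : (d.-1.+1 = d)%N by rewrite prednK.
have e_last : e (vs d.-1) r by rewrite -vsd -{2}d1; apply: vs_edge; rewrite d1.
have sdE : sd d.-1 = side e (vs d.-1) r by rewrite /sd d1 vsd.
have gdvs i j : (i <= j <= d)%N -> (gdist e (vs i) (vs j) <= j - i)%N by exact: gdist_vs.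
(* The vertex [vs 1%N] is within [d.-1] of [r], so membership in the core would contradict the
   minimality of [d]. *)
have v1S : vs 1%N \notin subtree_core e.
  apply/negP => v1S; have := set_dist_le e v1S rZ; rewrite -[set_dist _ _ _]/d -vsd.
  move=> /leq_trans/(_ (gdvs 1%N d _)); rewrite d_gt0 leqnn => /(_ isT).
  by rewrite subn1 -{1}d1 ltnn.
have e01 : e (vs 0%N) (vs 1%N) by exact: vs_edge.
have nb_lt : (nb_subtrees e (vs 1%N) < nb_subtrees e (vs 0%N))%N.
  move: v1S; rewrite inE negb_forall => /existsP [u]; rewrite -ltnNge => /leq_trans.
  by apply; move: vS; rewrite inE vs0 => /forallP.
(* With [k] the number of vertices other than [v] outside [sd 0%N], the comparison of subtree counts
   gives [#|sd 0%N| < 2 ^ k]. Since [#|sd 0%N| = n.-1 - k], minimality of [g] yields [g <= k]. *)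
have cardA : (g < #|~: sd 0%N|)%N.
  have vA : (0 < #|~: sd 0%N|)%N.
    by apply/card_gt0P; exists (vs 0%N); rewrite inE side_notin.
  have := nb_lt; rewrite nb_subtrees_ltn // => lt_avoid.
  have := nb_avoid_ge sym_e irr_e e01; have := nb_avoid_le irr_e acyc_e e01.
  move=> h1 h2; have cC := cardsC (sd 0%N); rewrite card_ord in cC.
  have h : (#|sd 0%N| < 2 ^ #|~: sd 0%N|.-1)%N.
    exact: leq_trans (leq_ltn_trans h2 lt_avoid) h1.
  suff : (g <= #|~: sd 0%N|.-1)%N by move: vA; clear; lia.
  by apply: g_min; move: h cC vA; clear; lia.
have zR : r \in sd d.-1 by rewrite sdE; exact: side_self.
have out_r w : e r w -> w \notin sd d.-1 -> w = vs d.-1.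
  move=> rw; rewrite sdE => wn.
  by have [] := side_cross irr_e acyc_e e_last rw (side_self _ _ _) wn.
pose B := sd d.-1 :\ r.
have in_B w : e r w -> w \in sd d.-1 -> w \in B.
  move=> rw ws; rewrite in_setD1 ws andbT; apply: contraTneq rw => ->; by rewrite irr_e.
have bdB x z : x \in B -> e x z -> z \notin B -> z = r.
  rewrite !in_setD1 negb_and negbK => /andP [xr xs] xz /orP [/eqP //|zs].
  have := side_cross irr_e acyc_e e_last xz; rewrite -sdE => /(_ xs zs) [xE _].
  by rewrite xE eqxx in xr.
(* The sign change at [r] is visible beyond [r]. For a characteristic edge, its other end cannot be
   [vs d.-1], which is closer to the core; for a characteristic vertex, the neighbours of opposite
   signs are not both [vs d.-1]. *)
have [w wB wY] : exists2 w, w \in B & (y r = 0 /\ y w != 0) \/ (y r * y w < 0).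
  case: (char_pt_neighbours (YE r) (cover_char_pt sym_e rZ)) => [[w rw Yrw]|].
    exists w; last by right.
    apply: in_B => //; apply/negPn/negP => /(out_r w rw) wE.
    have wZ : w \in Z := cover_char_edge rw Yrw.
    have := set_dist_le e vS wZ; rewrite -[set_dist _ _ _]/d wE -vs0.
    move=> /leq_trans/(_ (gdvs 0%N d.-1 (leq_pred d))).
    by rewrite subn0 -{1}d1 ltnn.
  case=> Yr [u [w [ru rw Yu Yw]]].
  have [uB|uB] := boolP (u \in sd d.-1).
    by exists u; [exact: in_B | left; rewrite gt_eqF].
  exists w; last by left; rewrite lt_eqF.
  apply: in_B => //; apply/negPn/negP => /(out_r w rw) wE.
  by move: Yw; rewrite wE -(out_r u ru uB) ltNge ltW.
have [psi [psi0 psiB psiw Epsi]] := char_outside_le sym_e YE bdB wB wY.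
have spsi : 0 < \sum_x psi x.
  by rewrite (bigD1 w) //= ltr_pwDl // sumr_ge0.
(* The vertex [r] separates the support of [psi], inside [B], from that of [phi], outside
   [sd d.-1]. *)
have gapC (phi : 'I_n -> R) : (forall x, x \in sd d.-1 -> phi x = 0) ->
    2 * mu * sqnorm phi <= energy e phi.
  move=> phi0; apply: (disjoint_supports sym_e gap _ spsi Epsi) => x z px pz.
  have xs : x \notin sd d.-1 by apply: contra px => /phi0 ->.
  have /setD1P [zr zs] : z \in B by apply: contraNT pz => /psiB ->.
  split; first by apply: contraNneq xs => ->.
  apply: contraNN zr => xz; rewrite sym_e in xz.
  have := side_cross irr_e acyc_e e_last xz; rewrite -sdE => /(_ zs xs) [-> _].
  exact: eqxx.
(* At least [g.+1] vertices lie outside [sd 0%N], a further [d.-1] are lost on the way to [sd d.-1],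
   and [r] is removed from it. *)
have cardB : (0 < #|B| <= n - g - 1 - d)%N.
  have pd : (d.-1 < d)%N by rewrite d1.
  have cs : (#|sd d.-1| + d.-1 <= #|sd 0%N|)%N.
    by have H := card_sd irr_e acyc_e vs_edge vs_inj pd; exact H.
  have cC := cardsC (sd 0%N); rewrite card_ord in cC.
  have cB := cardsD1 r (sd d.-1); rewrite zR -/B in cB.
  have B0 : (0 < #|B|)%N by apply/card_gt0P; exists w.

  by move: cs cC cB B0 cardA d_gt0; clear; lia.
exists mu, (rearr psi); split.
- by move: cardB; clear; lia.
- move=> k hk; apply: (rearr_eq0 psi0 psiB); apply: leq_trans hk.
  by case/andP: cardB.
- by have := rearr_sum psi id; rewrite card_ord => ->.
- have := rearr_sum psi (fun z => z ^+ 2); rewrite card_ord => ->.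
  have := rearr_energy sym_e conn_e psi; rewrite card_ord -[\sum_x psi x ^+ 2]/(sqnorm psi).
  by move=> h; have := le_trans h Epsi; rewrite -mulrA ler_pM2l.
move=> t a ad.
by apply: (branch_comparison sym_e irr_e conn_e acyc_e d_gt0 vs_edge vs_inj _
  (ltW mu0) gapC cardA ad).
Qed.

(** * Energy of functions on a path-star *)

Section PathStarEnergy.
Variables (R : realType) (n g : nat).
Hypotheses (g_ge2 : (2 <= g)%N) (g_le : (g + 3 <= n)%N).

Local Notation m := (n - g)%N.
Local Notation e := (@path_star n g).

Lemma sum_path_star (G : nat -> R) :
  \sum_(k < n) G k = \sum_(i < m) G (m.-1 - i)%N + \sum_(j < g) G (m + j)%N.
Proof.
have -> : \sum_(k < n) G k = \sum_(k < m + g) G k by rewrite subnK //; lia.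
rewrite big_split_ord /=; congr (_ + _).
rewrite (reindex_inj rev_ord_inj) /=; apply: eq_bigr => i _.
by congr G; have := ltn_ord i; lia.
Qed.

Lemma path_star_energy (F : nat -> R) :
  energy e (fun x => F x) =
  2 * (\sum_(k < m.-1) (F k - F k.+1) ^+ 2 +
       \sum_(j < g) (F m.-1 - F (m + j)%N) ^+ 2).
Proof.
(* Each edge is charged to its larger end, oriented from parent to child. *)
pose A (x y : 'I_n) : R :=
  ((0 < y)%N && (x == parent n g y :> nat))%:R * (F x - F y) ^+ 2.
have EA : energy e (fun x => F x) = \sum_(x < n) \sum_(y < n) (A x y + A y x).
  apply: eq_bigr => x _; rewrite big_mkcond; apply: eq_bigr => y _ /=.
  have sq : (F y - F x) ^+ 2 = (F x - F y) ^+ 2 by ring.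
  rewrite /A sq (path_starE g_ge2 g_le).
  have [/andP [y0 /eqP xE]|_] := boolP ((0 < y)%N && (x == parent n g y :> nat)); last first.
    by rewrite orFb mul0r add0r; case: (_ && _); rewrite ?mul1r ?mul0r.
  have := parent_lt g_ge2 g_le y0; rewrite -xE => xy.
  have -> : (0 < x)%N && (y == parent n g x :> nat) = false.
    apply/negP => /andP [x0 /eqP yE].
    by have := parent_lt g_ge2 g_le x0; rewrite -yE; lia.
  by rewrite mul1r mul0r addr0.
have -> : energy e (fun x => F x) = 2 * \sum_(y < n) \sum_(x < n) A x y.
  rewrite EA mulr_natl mulr2n [X in X + _]exchange_big -big_split /=.
  by apply: eq_bigr => x _; rewrite -big_split /=.
congr (_ * _).
pose G k := (0 < k)%N%:R * (F (parent n g k) - F k) ^+ 2.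
have -> : \sum_(y < n) \sum_(x < n) A x y = \sum_(k < n) G k.
  apply: eq_bigr => y _; rewrite /A /G; have [y0|y0] := posnP y.
    by rewrite big1 ?mul0r // => x _; rewrite mul0r.
  have pn : (parent n g y < n)%N by apply: ltn_trans (parent_lt g_ge2 g_le y0) (ltn_ord y).
  rewrite (bigD1 (Ordinal pn)) //= eqxx big1 ?addr0 // => x /negPf xn.
  by rewrite -[x == _ :> nat]/(x == Ordinal pn) xn mul0r.
have -> : \sum_(k < n) G k = \sum_(k < m.-1.+1 + g) G k.
  by rewrite (_ : (m.-1.+1 + g = n)%N) //; lia.
rewrite big_split_ord big_ord_recl /= {1}/G mul0r add0r; congr (_ + _).
  apply: eq_bigr => k _; rewrite /G /parent /= mul1r ifT //.
  by have := ltn_ord k; rewrite /bump; lia.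
apply: eq_bigr => j _; rewrite /G /parent.
have -> : (m.-1.+1 + j = m + j)%N by lia.
have -> : (0 < m + j)%N by move: g_le; clear; lia.
rewrite ifF ?mul1r //; apply/negbTE; rewrite -leqNgt; exact: leq_addr.
Qed.

(** The assumed inequality concerns functions equal on all leaves. A general [phi] is reached by
    applying it once per leaf, with [t] the value there, and averaging over the [g] leaves. *)
Lemma path_star_core_side_gap (d : nat) (mu : R) (phi : 'I_n -> R) :
  (d <= m.-1)%N ->
  (forall t (a : nat -> R), a d = 0 ->
     mu * (g%:R * t ^+ 2 + \sum_(i < d) a i ^+ 2) <=
     g%:R * (t - a 0%N) ^+ 2 + \sum_(i < d) (a i - a i.+1) ^+ 2) ->
  (forall x : 'I_n, (x <= m.-1 - d)%N -> phi x = 0) ->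
  2 * mu * sqnorm phi <= energy e phi.
Proof.
move=> dm H phi0; pose F k := oapp phi 0 (insub k).
have FE (x : 'I_n) : F x = phi x by rewrite /F valK.
have F0 k : (k <= m.-1 - d)%N -> F k = 0.
  by rewrite /F; case: insubP => //= x _ xk kd; apply: phi0; rewrite xk.
have -> : energy e phi = energy e (fun x => F x).
  by apply: eq_bigr => x _; apply: eq_bigr => y _; rewrite !FE.
(* The values of [phi] along the path, read from the center outwards. *)
pose a i := F (m.-1 - i)%N.
have ad i : (d <= i)%N -> a i = 0 by move=> di; apply: F0; lia.
have -> : sqnorm phi = \sum_(i < d) a i ^+ 2 + \sum_(j < g) F (m + j)%N ^+ 2.
  transitivity (\sum_(k < n) F k ^+ 2); first by apply: eq_bigr => x _; rewrite FE.
  rewrite (sum_path_star (fun k => F k ^+ 2)); congr (_ + _).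
  rewrite [RHS](big_ord_widen m (fun i => a i ^+ 2)); last by move: dm; clear; lia.
  rewrite [RHS]big_mkcond /=; apply: eq_bigr => i _.
  by case: ltnP => // /ad; rewrite /a => ->; rewrite expr0n.
rewrite path_star_energy -mulrA ler_pM2l //.
have Epath : \sum_(i < d) (a i - a i.+1) ^+ 2 <= \sum_(k < m.-1) (F k - F k.+1) ^+ 2.
  rewrite [leRHS](reindex_inj rev_ord_inj) /=.
  rewrite (big_ord_widen m.-1 (fun i => (a i - a i.+1) ^+ 2)) //.
  rewrite big_mkcond; apply: ler_sum => i _; case: ifP => _; last exact: sqr_ge0.
  have im := ltn_ord i; rewrite /a.
  have -> : (m.-1 - i.+1).+1 = (m.-1 - i)%N by lia.
  by rewrite -sqrrN opprB.
apply: le_trans (lerD Epath (lexx _)).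
have g0 : 0 < g%:R :> R by rewrite ltr0n; lia.
rewrite -(ler_pM2l g0).
have Hj (j : 'I_g) := H (F (m + j)%N) a (ad d (leqnn d)).
set S1 := \sum_(i < d) a i ^+ 2; set S2 := \sum_(j < g) F (m + j)%N ^+ 2.
set S4 := \sum_(i < d) _ ^+ 2; set S3 := \sum_(j < g) _ ^+ 2.
have -> : g%:R * (mu * (S1 + S2)) = \sum_(j < g) mu * (g%:R * F (m + j)%N ^+ 2 + S1).
  rewrite -mulr_sumr big_split /= sumr_const card_ord -mulr_sumr -/S2.
  by rewrite -[S1 *+ g]mulr_natl; ring.
have -> : g%:R * (S4 + S3) = \sum_(j < g) (g%:R * (F (m + j)%N - a 0%N) ^+ 2 + S4).
  rewrite big_split /= sumr_const card_ord -mulr_sumr -[S4 *+ g]mulr_natl addrC mulrDr.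
  congr (_ + _); rewrite /S3; congr (_ * _); apply: eq_bigr => j _.
  by rewrite /a subn0; ring.
by apply: ler_sum => j _; exact: Hj.
Qed.

End PathStarEnergy.

(** * Distance from the center to the characteristic set of a path-star *)

Section PathStarDistance.
Variables (R : realType) (n g : nat).
Hypotheses (g_ge2 : (2 <= g)%N) (g_le : (g + 3 <= n)%N).

Local Notation m := (n - g)%N.
Local Notation e := (@path_star n g).

(** Placing all leaves at height [m], the height [minn x m] drops by at most one along an edge, and
    the center has height [m.-1]. *)
Lemma path_star_dist (d : nat) (w : 'I_n) :
  (gdist e (star_center g_ge2 g_le) w < d <= m.-1)%N -> (m.-1 - d < w)%N.
Proof.
move=> /andP [wd dm].
have gn : (gdist e (star_center g_ge2 g_le) w < #|'I_n|)%N.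
  by apply: leq_trans wd _; rewrite card_ord; move: dm; clear; lia.
have [p [pp _] [lp sp]] := gdistP gn.
have step (x y : 'I_n) : e x y -> (minn x m <= (minn y m).+1)%N.
  by rewrite (path_starE g_ge2 g_le) /parent; do 2 case: ifP; move: g_le; clear; lia.
have walk (q : seq 'I_n) (x : 'I_n) : path e x q -> (minn x m <= minn (last x q) m + size q)%N.
  elim: q x => [|y q IHq] x /=; first by rewrite addn0.
  by move=> /andP [/step xy /IHq]; move: xy; clear; lia.
have szp : (size p < d)%N by rewrite sp.
have h : (minn m.-1 m <= minn w m + size p)%N by have := walk p _ pp; rewrite lp.
by move: h szp dm g_le; generalize (size p); clear; lia.
Qed.

(** The profile vanishes at the center and on the leaves, so only path edges contribute to its
    energy. *)
Lemma path_star_far (d : nat) (F : nat -> R) (mu : R) :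
  (0 < d <= m.-1)%N ->
  (forall k, (n - g - 1 - d <= k)%N -> F k = 0) ->
  \sum_(k < n.-1) (F k - F k.+1) ^+ 2 <= mu * \sum_(k < n) F k ^+ 2 ->
  energy e (fun x => F x) <= 2 * mu * sqnorm (fun x : 'I_n => F x).
Proof.
move=> /andP [d0 dm] F0 EF; rewrite path_star_energy // -mulrA ler_pM2l //.
apply: le_trans EF; rewrite [X in _ + X]big1 ?addr0 => [|j _]; last first.
  by rewrite !F0 ?subrr ?expr0n //; move: d0; clear; lia.
have mn : (m.-1 <= n.-1)%N by clear; lia.
rewrite (big_ord_widen n.-1 (fun k => (F k - F k.+1) ^+ 2) mn) big_mkcond.
by apply: ler_sum => k _; case: ifP => _ //; exact: sqr_ge0.
Qed.

Lemma star_side (d : nat) (mu : R) (F : nat -> R) (Yg : 'cV[R]_n) :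
  (n.-1 < 2 ^ g + g)%N -> is_fiedler_vector e Yg ->
  (0 < d)%N -> (d + g + 1 < n)%N ->
  (forall k, (n - g - 1 - d <= k)%N -> F k = 0) ->
  0 < \sum_(k < n) F k ->
  \sum_(k < n.-1) (F k - F k.+1) ^+ 2 <= mu * \sum_(k < n) F k ^+ 2 ->
  (forall t (a : nat -> R), a d = 0 ->
     mu * (g%:R * t ^+ 2 + \sum_(i < d) a i ^+ 2) <=
     g%:R * (t - a 0%N) ^+ 2 + \sum_(i < d) (a i - a i.+1) ^+ 2) ->
  (d <= dist_core_char e Yg)%N.
Proof.
move=> g_large [_ [mu' mu2 LY]] d0 dgn F0 sF EF HC.
have sym_e := path_star_sym g_ge2 g_le; have irr_e := path_star_irr g_ge2 g_le.
have dm : (d <= m.-1)%N by move: dgn; clear; lia.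
apply: set_dist_ge => [|u w /(star_core g_ge2 g_le g_large) -> wZ].
  by rewrite card_ord; move: dgn; clear; lia.
rewrite leqNgt; apply/negP => wd.
have qw : (m.-1 - d < w)%N by apply: path_star_dist; rewrite wd.
have qn : (m.-1 - d < n)%N by apply: ltn_trans qw (ltn_ord w).
(* The vertex [q] lies on the path at distance [d] from the center, and [S] is the part of the
   path-star beyond [q] on the side of the center. *)
pose q := Ordinal qn; pose S := [set x : 'I_n | (q < x)%N].
have YE x : lap e (fun i => Yg i 0) x = mu' * Yg x 0 by rewrite -laplacian_lap // LY mxE.
have qm : (m.-1 - d < m.-1)%N by move: d0 dm; clear; lia.
have parent_q (x y : 'I_n) : e x y -> (y <= q < x)%N -> y = q.
  move=> xy /andP [yq qx]; have := path_star_down g_ge2 g_le xy (leq_trans yq (ltnW qx)).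
  rewrite /parent; case: ifP => _ yE; apply: val_inj; move: yE yq qx qm => /=; clear; lia.
have Sconn : cset e S.
  have qm' : ((m.-1 - d).+1 < m)%N by move: qm; clear; lia.
  have Lm : {in [set x : 'I_n | (m <= x)%N], forall x : 'I_n, (m <= x)%N}.
    by move=> x; rewrite inE.
  have := star_cset g_ge2 g_le qm' Lm; congr (cset _ _).
  apply/setP => x; rewrite !inE /=; move: qm'; clear; lia.
have [phi Ephi phi0] : exists2 phi : 'I_n -> R, energy e phi < 2 * mu' * sqnorm phi &
    forall x, x \notin S -> phi x = 0.
  apply: (char_inside_lt sym_e YE _ _ _ _ (cover_char_pt sym_e wZ)).
  - exact/csetP.
  - move=> x y; rewrite !inE -leqNgt => qx xy yq; apply: parent_q xy _.
    by rewrite yq qx.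
  - by rewrite inE ltnn.
  - by rewrite inE.
have Ephi' : 2 * mu * sqnorm phi <= energy e phi.
  apply: path_star_core_side_gap HC _ => // x xq.
  by apply: phi0; rewrite inE -leqNgt.
(* The same [phi] has quotient at least [mu] and less than [mu']. *)
have mu_lt : mu < mu'.
  rewrite ltNge; apply/negP => le_mu; have := le_lt_trans Ephi' Ephi.
  by rewrite ltNge ler_wpM2r ?sqnorm_ge0 // ler_pM2l.
pose psi (x : 'I_n) := F x.
have dm' : (0 < d <= m.-1)%N by rewrite d0.
have Epsi : energy e psi <= 2 * mu' * sqnorm psi.
  apply: le_trans (path_star_far dm' F0 EF) _; rewrite ler_wpM2r ?sqnorm_ge0 //.
  by rewrite ler_pM2l // ltW.
(* Now [psi] lives below [q] and [phi] above it, so the gap at [mu'] contradicts the strict bound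
   [Ephi]. *)
have := disjoint_supports sym_e (spectral_gap sym_e irr_e mu2) (phi := phi) _ sF Epsi.
rewrite leNgt Ephi => H; case: notF; apply: H => x y px py.
have qx : (q < x)%N.
  by rewrite ltnNge; apply: contra px => xq; rewrite phi0 // inE -leqNgt.
have yq : (y < q)%N.
  rewrite ltnNge; apply: contra py => qy; rewrite /psi F0 //.
  by move: qy => /=; clear; lia.
split; first by apply: contraTneq qx => ->; rewrite -leqNgt ltnW.
apply/negP => xy; have := parent_q x y xy; rewrite (ltnW yq) qx => /(_ isT) yE.
by rewrite yE ltnn in yq.
Qed.

End PathStarDistance.

(** * Choice of the number of leaves and comparison of the two distances *)

Theorem theorem3p1 (R : realType) (n : nat) (hn : (5 <= n)%N) :
  exists g : nat, (2 <= g <= n - 3)%N /\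
    forall (e : rel 'I_n) (Y Yg : 'cV[R]_n),
      is_tree [set: 'I_n] e ->
      is_fiedler_vector e Y ->
      is_fiedler_vector (@path_star n g) Yg ->
      (dist_core_char e Y <= dist_core_char (@path_star n g) Yg)%N.
Proof.
have large : (n.-1 < 2 ^ (n - 3) + (n - 3))%N.
  have : (2 ^ 2 <= 2 ^ (n - 3))%N by rewrite leq_exp2l //; lia.
  by move: hn; generalize (2 ^ (n - 3))%N; clear; lia.
(* The least solution [g] of [P] lies in the required range: 0 and 1 fail since [n] is at least 5,
   and [n - 3] is a solution by [large]. *)
pose P k := (n.-1 < 2 ^ k + k)%N.
have exP : exists k, P k by exists (n - 3)%N.
case: (ex_minnP exP) => g g_large g_min.
have g_ge2 : (2 <= g)%N.
  by move: g_large; rewrite /P; case: g {g_min} => [|[|g]] //; move: hn; clear; lia.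
have g_le3 : (g <= n - 3)%N by exact: g_min.
have g_le : (g + 3 <= n)%N by move: g_le3 hn; clear; lia.
exists g; split; first by rewrite g_ge2.
move=> e Y Yg tree_e fY fYg.
have [->|d0] := posnP (dist_core_char e Y); first exact: leq0n.
have n1 : (1 < n)%N by exact: leq_trans hn.
have [mu [F [dgn F0 sF EF HC]]] := tree_side n1 g_min tree_e fY d0.
exact: (star_side g_ge2 g_le g_large fYg d0 dgn F0 sF EF HC).
Qed.
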